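(* Let $\mathcal{A}=\mathcal{A}_n^{\bar q,\Lambda}(\mathbb{K})$ with no $q_k$ a root of unity, and let $\varphi\in\mathrm{Aut}_{\mathbb{K}}(\mathcal{A})$. Then there exist a permutation $\sigma$ of $\{1,\dots,n\}$ and $\alpha_1,\dots,\alpha_n\in\mathbb{K}^*$ such that for each $i$, either $\varphi(x_i)=\alpha_ix_{\sigma(i)},\ \varphi(y_i)=\alpha_i^{-1}y_{\sigma(i)}$ and $q_i=q_{\sigma(i)}$, or $\varphi(x_i)=\alpha_iy_{\sigma(i)},\ \varphi(y_i)=-q_i^{-1}\alpha_i^{-1}x_{\sigma(i)}$ and $q_i=q_{\sigma(i)}^{-1}$.
   Context: Let $\mathbb{K}$ be a field, $n\ge 1$, $\bar q=(q_1,\dots,q_n)\in(\mathbb{K}^* )^n$, and $\Lambda=(\lambda_{ij})$ an $n\times n$ matrix over $\mathbb{K}^*$ with $\lambda_{ij}=\lambda_{ji}^{-1}$, $\lambda_{ii}=1$. $\mathcal{A}_n^{\bar q,\Lambda}(\mathbb{K})$ is the $\mathbb{K}$-algebra generated by $x_1,y_1,\dots,x_n,y_n$ with relations: for $1\le i<j\le n$, $x_ix_j=\lambda_{ij}x_jx_i$, $y_jy_i=\lambda_{ji}y_iy_j$, $x_iy_j=\lambda_{ji}y_jx_i$, $x_jy_i=\lambda_{ij}y_ix_j$; and $x_iy_i-q_iy_ix_i=1$ for all $i$. *)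

(* Defs.v *)
From HB Require Import structures.
From mathcomp Require Import all_boot all_order all_algebra all_fingroup.
Set Implicit Arguments. Unset Strict Implicit. Unset Printing Implicit Defensive.
Import GRing.Theory.
Local Open Scope ring_scope.

Definition qwa_rels (K : fieldType) (n : nat) (q : 'I_n -> K)
  (lam : 'I_n -> 'I_n -> K) (B : algType K) (x y : 'I_n -> B) : Prop :=
  (forall i j : 'I_n, (i < j)%N ->
     [/\ x i * x j = lam i j *: (x j * x i),
         y j * y i = lam j i *: (y i * y j),
         x i * y j = lam j i *: (y j * x i)
       & x j * y i = lam i j *: (y i * x j)])
  /\ (forall i : 'I_n, x i * y i - q i *: (y i * x i) = 1).

(* (A, x, y) is a presentation of A_n^{q,Lambda}(K): the relations hold and
   it is universal (initial) among K-algebras with such elements. *)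
Definition is_qwa (K : fieldType) (n : nat) (q : 'I_n -> K)
  (lam : 'I_n -> 'I_n -> K) (A : algType K) (x y : 'I_n -> A) : Prop :=
  qwa_rels q lam x y /\
  (forall (B : algType K) (u v : 'I_n -> B), qwa_rels q lam u v ->
     (exists f : {lrmorphism A -> B}, forall i, f (x i) = u i /\ f (y i) = v i)
     /\ (forall f g : {lrmorphism A -> B},
           (forall i, f (x i) = g (x i) /\ f (y i) = g (y i)) -> f =1 g)).

(* Main.v *)
Require Import Defs.
From HB Require Import structures.
From mathcomp Require Import all_boot all_order all_algebra all_fingroup.
From mathcomp Require Import finmap.
From mathcomp.multinomials Require Import monalg.
From Stdlib Require Import ClassicalEpsilon.
From mathcomp Require Import zify ring.
Set Implicit Arguments. Unset Strict Implicit. Unset Printing Implicit Defensive.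
Import Order.TTheory GRing.Theory Num.Theory.
Local Open Scope ring_scope.

(** Put [z_i = x_i y_i - y_i x_i = 1 + (q_i - 1) y_i x_i].  The algebra embeds in
    the quantum torus with generators [z_i] and [X_i], by [x_i -> X_i] and
    [y_i -> (z_i - 1) X_i^-1 / (q_i - 1)], so leading and trailing exponents for a
    group order on [Z^2n] are available.  If [u] is normal, [u w = b u] with [w]
    a monomial of the torus forces [b] to be a multiple of [w];
      taking [w = z_i, x_i]
    here, and [w = y_i] in the twin embedding that exchanges the roles of [x] and
    [y], shows that [u] is a multiple of a monomial in the [z_i].  Hence an
    automorphism [phi] permutes the [z_i] up to scalars,
    [phi z_i = a_i z_(sigma i)].  The eigenvalues of conjugation by the [z_j] make
    [phi x_i] homogeneous of degree [+-1] in [X_(sigma i)] and of degree [0] in the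
    others, and [phi x_i * phi y_i] is a binomial in [z_(sigma i)], so one of the
    factors is a monomial; non-invertibility of [x_(sigma i)] and [y_(sigma i)]
    then leaves only the two announced forms. *)

(** * Linear extension from a basis *)

Section LinearExtension.
Variables (K : fieldType) (B : choiceType) (V : lmodType K) (f : B -> V).

Definition mext (u : {malg K[B]}) : V := \sum_(k <- msupp u) u@_k *: f k.

Lemma mextw (d : {fset B}) (u : {malg K[B]}) :
  (msupp u `<=` d)%fset -> mext u = \sum_(k <- d) u@_k *: f k.
Proof.
move=> le; rewrite /mext (big_fset_incl _ le) //= => k _.
by rewrite -mcoeff_eq0 => /eqP ->; rewrite scale0r.
Qed.

Lemma mext_is_linear : linear mext.
Proof.
move=> a u v; set d := (msupp u `|` msupp v)%fset.
rewrite (@mextw d u) ?(@mextw d v) ?fsubsetUl ?fsubsetUr //.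
rewrite (@mextw d (a *: u + v)).
  rewrite scaler_sumr -big_split /=; apply: eq_bigr => k _.
  by rewrite mcoeffD mcoeffZ scalerDl scalerA.
apply: fsubset_trans (msuppD_le _ _) _; apply: fsetSU; exact: msuppZ_le.
Qed.
HB.instance Definition _ :=
  GRing.isLinear.Build K {malg K[B]} V *:%R mext mext_is_linear.

Lemma mextU k : mext << k >> = f k.
Proof. by rewrite /mext msuppU oner_eq0 big_seq_fset1 mcoeffUU scale1r. Qed.
End LinearExtension.

Lemma malg_ind_lin (K : fieldType) (B : choiceType) (P : {malg K[B]} -> Prop) :
  P 0 -> (forall a k u, P u -> P (a *: << k >> + u)) -> forall u, P u.
Proof.
move=> P0 PD u; rewrite (monalgE u); elim/big_rec: _ => // k v _ /(PD u@_k k).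
congr P; congr (_ + _); apply/malgP => l.
by rewrite mcoeffZ !mcoeffU mulrnAr mulr1.
Qed.

Lemma mcoeffU1 (K : fieldType) (B : choiceType) (k l : B) :
  (<< k >> : {malg K[B]})@_l = (k == l)%:R.
Proof. by rewrite mcoeffU. Qed.

(** * Group algebras twisted by a bicharacter *)

Record bicharacter (K : fieldType) (G : zmodType) := Bicharacter {
  bich :> G -> G -> K;
  bichDl : forall g h k, bich (g + h) k = bich g k * bich h k;
  bichDr : forall g h k, bich g (h + k) = bich g h * bich g k;
  bich_neq0 : forall g h, bich g h != 0 }.

Lemma bich0r (K : fieldType) (G : zmodType) (c : bicharacter K G) g : c g 0 = 1.
Proof.
by apply: (mulfI (bich_neq0 c g 0)); rewrite -bichDr addr0 mulr1.
Qed.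

Lemma bich0l (K : fieldType) (G : zmodType) (c : bicharacter K G) g : c 0 g = 1.
Proof.
by apply: (mulfI (bich_neq0 c 0 g)); rewrite -bichDl addr0 mulr1.
Qed.

(** Keeping [c] in the type lets the ring structure depend on the twist. *)
Definition twisted_malg (K : fieldType) (G : zmodType) (c : bicharacter K G) :
  Type :=
  {malg K[G]}.

Definition malg_mon (K : fieldType) (G : zmodType) (c : bicharacter K G)
  (g : G) : twisted_malg c := << g >>.

Section TwistedAlgebra.
Variables (K : fieldType) (G : zmodType) (c : bicharacter K G).
Local Notation T := (twisted_malg c).
Local Notation tmon := (malg_mon c).

HB.instance Definition _ := GRing.Lmodule.copy T {malg K[G]}.

Definition tmul (u v : T) : T :=
  mext (fun g => mext (fun h => c g h *: tmon (g + h)) v) u.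

Lemma tmul_linl v : linear (tmul^~ v).
Proof. by move=> a u w; rewrite /tmul linearP. Qed.

Lemma tmul_linr u : linear (tmul u).
Proof.
move=> a v w; rewrite /tmul /mext scaler_sumr -big_split /=; apply: eq_bigr => g _.
by rewrite -![\sum_(k <- _) _]/(mext _ _) linearP scalerDr !scalerA [a * _]mulrC.
Qed.

Lemma tmul_mon g h : tmul (tmon g) (tmon h) = c g h *: tmon (g + h).
Proof. by rewrite /tmul !mextU. Qed.

Lemma tmulDl u v w : tmul (u + v) w = tmul u w + tmul v w.
Proof. by have := tmul_linl w 1 u v; rewrite !scale1r. Qed.
Lemma tmulDr u v w : tmul w (u + v) = tmul w u + tmul w v.
Proof. by have := tmul_linr w 1 u v; rewrite !scale1r. Qed.
Lemma tmul0l u : tmul 0 u = 0.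
Proof. by apply: (@addrI _ (tmul 0 u)); rewrite -tmulDl !addr0. Qed.
Lemma tmul0r u : tmul u 0 = 0.
Proof. by apply: (@addrI _ (tmul u 0)); rewrite -tmulDr !addr0. Qed.
Lemma tmulZl a u v : tmul (a *: u) v = a *: tmul u v.
Proof. by have := tmul_linl v a u 0; rewrite !addr0 tmul0l addr0. Qed.
Lemma tmulZr a u v : tmul u (a *: v) = a *: tmul u v.
Proof. by have := tmul_linr u a v 0; rewrite !addr0 tmul0r addr0. Qed.

Lemma malg_mon_ind (P : T -> Prop) :
  P 0 -> (forall a g u, P u -> P (a *: tmon g + u)) -> forall u, P u.
Proof. by move=> P0 PD; apply: malg_ind_lin => // a g u /(PD a g). Qed.

(** A bicharacter is a 2-cocycle: both sides carry the scalar [c g h * c g k * c h k]. *)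
Lemma tmulA_mon g h k :
  tmul (tmon g) (tmul (tmon h) (tmon k)) = tmul (tmul (tmon g) (tmon h)) (tmon k).
Proof.
rewrite !tmul_mon tmulZl tmulZr !tmul_mon !scalerA addrA bichDl bichDr.
by congr (_ *: _); ring.
Qed.

Lemma tmulA : associative tmul.
Proof.
move=> u v w; elim/malg_mon_ind: u => [|a g u IHu]; first by rewrite !tmul0l.
rewrite !tmulDl !tmulZl IHu => {IHu}; suff -> : forall v w,
  tmul (tmon g) (tmul v w) = tmul (tmul (tmon g) v) w by [].
move=> {u} {}v {}w.
elim/malg_mon_ind: v => [|b h v IHv]; first by rewrite tmul0l tmul0r tmul0l.
rewrite tmulDl tmulZl !tmulDr !tmulZr IHv tmulDl tmulZl => {IHv}.
suff -> : forall w, tmul (tmon g) (tmul (tmon h) w) = tmul (tmul (tmon g) (tmon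
  h)) w
  by [].
move=> {v} {}w; elim/malg_mon_ind: w => [|d k w IHw]; first by rewrite !tmul0r.
by rewrite !tmulDr !tmulZr IHw tmulA_mon.
Qed.

Lemma tmul1l : left_id (tmon 0) tmul.
Proof.
move=> u; elim/malg_mon_ind: u => [|a g u IHu]; first by rewrite !tmul0r.
by rewrite tmulDr tmulZr IHu tmul_mon bich0l add0r scale1r.
Qed.

Lemma tmul1r : right_id (tmon 0) tmul.
Proof.
move=> u; elim/malg_mon_ind: u => [|a g u IHu]; first by rewrite !tmul0l.
by rewrite tmulDl tmulZl IHu tmul_mon bich0r addr0 scale1r.
Qed.

Lemma malg_mon_neq0 g : tmon g != 0.
Proof. by rewrite monalgU_eq0 oner_eq0. Qed.

Fact tmulDl_ : left_distributive tmul +%R.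
Proof. by move=> u v w; rewrite tmulDl. Qed.
Fact tmulDr_ : right_distributive tmul +%R.
Proof. by move=> u v w; rewrite tmulDr. Qed.

HB.instance Definition _ := GRing.Zmodule_isNzRing.Build T
  tmulA tmul1l tmul1r tmulDl_ tmulDr_ (malg_mon_neq0 0).
Fact tscaleAl (a : K) (u v : T) : a *: (u * v) = (a *: u) * v.
Proof. by rewrite -[RHS]/(tmul _ _) tmulZl. Qed.
HB.instance Definition _ := GRing.Lmodule_isLalgebra.Build K T tscaleAl.
Fact tscaleAr (a : K) (u v : T) : a *: (u * v) = u * (a *: v).
Proof. by rewrite -[RHS]/(tmul _ _) tmulZr. Qed.
HB.instance Definition _ := GRing.Lalgebra_isAlgebra.Build K T tscaleAr.


Lemma malg_monE (u : T) : u = \sum_(h <- msupp u) u@_h *: tmon h.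
Proof.
rewrite {1}(monalgE u); apply: eq_bigr => h _; apply/malgP => l.
by rewrite mcoeffZ !mcoeffU mulrnAr mulr1.
Qed.
End TwistedAlgebra.

(** Abstract interface: later arguments see only the monomial basis, its coefficient functions and
    the product rule. *)
Record twisted_algebra (K : fieldType) (G : zmodType) (c : bicharacter K G) :=
  TwistedAlgebra {
  twalg :> algType K;
  twmon : G -> twalg;
  twcoef : twalg -> G -> K;
  twsupp : twalg -> seq G;
  twcoefP : forall a u v g, twcoef (a *: u + v) g = a * twcoef u g + twcoef v g;
  twcoef_mon : forall g h, twcoef (twmon g) h = (g == h)%:R;
  twsupp_uniq : forall u, uniq (twsupp u);
  mem_twsupp : forall u g, (g \in twsupp u) = (twcoef u g != 0);
  twmonE : forall u, u = \sum_(g <- twsupp u) twcoef u g *: twmon g;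
  twmonM : forall g h, twmon g * twmon h = c g h *: twmon (g + h);
  twmon0 : twmon 0 = 1 }.

(* Opaque, so that unification never compares the underlying finite functions. *)
Definition twisted_model (K : fieldType) (G : zmodType) (c : bicharacter K G) :
  twisted_algebra c.
Proof.
apply: (@TwistedAlgebra K G c (twisted_malg c) (malg_mon c)
  (fun u g => mcoeff g u) (fun u => enum_fset (msupp u))).
- by move=> a u v g; rewrite mcoeffD mcoeffZ.
- by move=> g h; apply: mcoeffU1.
- by move=> u; apply: fset_uniq.
- by move=> u g; rewrite mcoeff_neq0.
- exact: malg_monE.
- exact: tmul_mon.
- by [].
Qed.

Definition twisted (K : fieldType) (G : zmodType) (c : bicharacter K G) :
  algType K :=
  twisted_model c.
Definition tmon (K : fieldType) (G : zmodType) (c : bicharacter K G) (g : G) :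
  twisted c := twmon (twisted_model c) g.
Definition tcoef (K : fieldType) (G : zmodType) (c : bicharacter K G)
  (u : twisted c) (g : G) : K := twcoef u g.
Definition tsupp (K : fieldType) (G : zmodType) (c : bicharacter K G)
  (u : twisted c) : seq G := twsupp u.

(** * Coefficients and supports in the twisted algebra *)

Section TwistedTheory.
Variables (K : fieldType) (G : zmodType) (c : bicharacter K G).
Local Notation T := (twisted c).
Local Notation tmon := (tmon c).
Implicit Types (u v : T) (g h : G).

Lemma tmonM g h : tmon g * tmon h = c g h *: tmon (g + h).
Proof. exact: twmonM. Qed.
Lemma tmon0 : tmon 0 = 1. Proof. exact: twmon0. Qed.
Lemma tcoef_mon g h : tcoef (tmon g) h = (g == h)%:R.
Proof. exact: twcoef_mon. Qed.
Lemma tsupp_uniq u : uniq (tsupp u).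
Proof. exact: twsupp_uniq. Qed.
Lemma mem_tsupp u g : (g \in tsupp u) = (tcoef u g != 0).
Proof. exact: mem_twsupp. Qed.
Lemma tmonE u : u = \sum_(g <- tsupp u) tcoef u g *: tmon g.
Proof. exact: twmonE. Qed.

Lemma tcoefD u v g : tcoef (u + v) g = tcoef u g + tcoef v g.
Proof. by have := twcoefP 1 u v g; rewrite scale1r mul1r. Qed.
Lemma tcoef0 g : tcoef (0 : T) g = 0.
Proof. by apply: (@addrI _ (tcoef (0 : T) g)); rewrite -tcoefD !addr0. Qed.
Lemma tcoefZ a u g : tcoef (a *: u) g = a * tcoef u g.
Proof. by have := twcoefP a u 0 g; rewrite addr0 -!/(tcoef _ _) tcoef0 addr0. Qed.
Lemma tcoefN u g : tcoef (- u) g = - tcoef u g.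
Proof. by rewrite -scaleN1r tcoefZ mulN1r. Qed.
Lemma tcoef_sum (J : Type) (r : seq J) (f : J -> T) g :
  tcoef (\sum_(j <- r) f j) g = \sum_(j <- r) tcoef (f j) g.
Proof. by apply: (big_morph (fun u => tcoef u g) (fun u v => tcoefD u v g));
  apply: tcoef0. Qed.

Lemma tcoef_inj u v : (forall g, tcoef u g = tcoef v g) -> u = v.
Proof.
move=> E; rewrite (tmonE u) (tmonE v) (perm_big (tsupp v)) /=.
  by apply: eq_bigr => g _; rewrite E.
by apply: uniq_perm; rewrite ?tsupp_uniq // => g; rewrite !mem_tsupp E.
Qed.

Lemma tmon_ind (P : T -> Prop) :
  P 0 -> (forall a g u, P u -> P (a *: tmon g + u)) -> forall u, P u.
Proof.
by move=> P0 PD u; rewrite (tmonE u); elim/big_rec: _ => // g v _; apply: PD.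
Qed.

Lemma tcoefMmonl g u h : tcoef (tmon g * u) (g + h) = c g h * tcoef u h.
Proof.
elim/tmon_ind: u => [|a k u IHu]; first by rewrite mulr0 !tcoef0 mulr0.
rewrite mulrDr !tcoefD IHu mulrDr -scalerAr !tcoefZ tmonM tcoefZ !tcoef_mon.
rewrite (inj_eq (addrI g)); case: eqP => [->|_]; last by rewrite !mulr0.
by rewrite mulrCA.
Qed.

Lemma tcoefMmonr g u h : tcoef (u * tmon g) (h + g) = c h g * tcoef u h.
Proof.
elim/tmon_ind: u => [|a k u IHu]; first by rewrite mul0r !tcoef0 mulr0.
rewrite mulrDl !tcoefD IHu mulrDr -scalerAl !tcoefZ tmonM tcoefZ !tcoef_mon.
rewrite (inj_eq (addIr g)); case: eqP => [->|_]; last by rewrite !mulr0.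
by rewrite mulrCA.
Qed.

Lemma tcoefM u v g : tcoef (u * v) g =
  \sum_(h <- tsupp u) tcoef u h * (c h (g - h) * tcoef v (g - h)).
Proof.
rewrite {1}(tmonE u) mulr_suml tcoef_sum; apply: eq_bigr => h _.
by rewrite -scalerAl tcoefZ -tcoefMmonl addrC subrK.
Qed.
End TwistedTheory.

(** * Group orders and leading exponents *)

(** Encodes a translation-invariant total order on [G], where [b < a] means [P (a - b)]. *)
Definition positive_cone (G : zmodType) (P : pred G) :=
  [/\ ~~ P 0, forall g h, P g -> P h -> P (g + h)
    & forall g, g != 0 -> P g || P (- g)].

(** Reversing the order turns trailing exponents into leading ones, so one theory serves both
    ends. *)
Lemma positive_cone_opp (G : zmodType) (P : pred G) :
  positive_cone P -> positive_cone (fun g => P (- g)).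
Proof.
case=> P0 PD PT; split=> [|g h Pg Ph|g g0]; first by rewrite oppr0.
  by rewrite opprD PD.
by rewrite PT // oppr_eq0.
Qed.

Lemma cone_max (G : zmodType) (P : pred G) (s : seq G) : positive_cone P ->
  s != [::] -> exists2 a, a \in s & forall b, b \in s -> b = a \/ P (a - b).
Proof.
case=> P0 PD PT; elim: s => // g [_ _|h s IH _].
  by exists g; rewrite ?mem_seq1 // => b; rewrite mem_seq1 => /eqP; left.
have [//|a ains amax] := IH; have [ga|/PT] := eqVneq (g - a) 0.
  have {ga} ->: g = a by apply/eqP; rewrite -subr_eq0 ga.
  exists a; first by rewrite mem_head.
  by move=> b; rewrite in_cons => /orP[/eqP|/amax //]; left.
case/orP => [Pga|Pag].
  exists g; first by rewrite mem_head.
  move=> b; rewrite in_cons => /orP[/eqP|/amax[->|Pab]]; [by left|by right|right].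
  by rewrite -(subrK a g) -addrA PD.
exists a; first by rewrite in_cons ains orbT.
move=> b; rewrite in_cons => /orP[/eqP ->|/amax //]; right.
by rewrite -opprB.
Qed.

Section Leading.
Variables (K : fieldType) (G : zmodType) (c : bicharacter K G) (P : pred G).
Hypothesis coneP : positive_cone P.
Local Notation T := (twisted c).

(** A relation instead of a function, so that [u = 0] calls for no default exponent. *)
Definition leading (u : T) (a : G) : Prop :=
  tcoef u a != 0 /\ forall b, tcoef u b != 0 -> b = a \/ P (a - b).

Lemma ex_leading (u : T) : u != 0 -> exists a, leading u a.
Proof.
move=> u0; have [|a au amax] := @cone_max _ _ (tsupp u) coneP.
  by apply: contra_neq u0 => s0; rewrite (tmonE u) s0 big_nil.
by exists a; split=> [|b bu]; [rewrite -mem_tsupp|apply/amax; rewrite mem_tsupp].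
Qed.

Lemma leadingM (u v : T) a b : leading u a -> leading v b -> tcoef (u * v) (a +
  b) != 0.
Proof.
case: coneP => P0 PD _ [ua amax] [vb bmax].
have au : a \in tsupp u by rewrite mem_tsupp.
rewrite tcoefM (bigD1_seq a) ?tsupp_uniq //= big_seq_cond big1 ?addr0 => [|h].
  by rewrite [a + b]addrC addrK !mulf_neq0 ?bich_neq0.
rewrite mem_tsupp => /andP[hu ha].
have [->|v0] := eqVneq (tcoef v (a + b - h)) 0; first by rewrite !mulr0.
have [/eqP|Pah] := amax _ hu; first by rewrite (negPf ha).
have [/eqP|] := bmax _ v0.
  by rewrite addrAC -[X in _ == X]add0r (inj_eq (addIr b)) subr_eq0 eq_sym
    (negPf ha).
move/(PD _ _ Pah) => Ps; case/negP: P0; congr P: Ps.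
by rewrite addrA [a - h + b]addrAC subrr.
Qed.

Lemma leading_neq0 (u : T) a : leading u a -> u != 0.
Proof. by case=> ua _; apply: contraNneq ua => ->; rewrite tcoef0. Qed.

Lemma leading_uniq (u : T) a b : leading u a -> leading u b -> a = b.
Proof.
case: coneP => P0 PD _ [ua amax] [ub bmax].
case: (bmax _ ua) => // Pba; case: (amax _ ub) => // /(PD _ _ Pba).
by rewrite addrA subrK subrr (negPf P0).
Qed.

Lemma leading_mon g : leading (tmon c g) g.
Proof.
split=> [|b]; rewrite tcoef_mon; first by rewrite eqxx oner_eq0.
by case: (g =P b) => [->|]; [left|rewrite eqxx].
Qed.

Lemma leadingM_max (u v : T) a b : leading u a -> leading v b ->
  leading (u * v) (a + b).
Proof.
move=> ua vb; split; first exact: leadingM.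
case: coneP ua vb => P0 PD _ [ua amax] [vb bmax] g.
rewrite tcoefM => s0.
have [h hu vh] : exists2 h, tcoef u h != 0 & tcoef v (g - h) != 0.
  have [/hasP[h hu /andP[? ?]]|/hasPn none] :=
    boolP (has (fun h => (tcoef u h != 0) && (tcoef v (g - h) != 0)) (tsupp u)).
    by exists h.
  case/eqP: s0; apply: big1_seq => h /= /none.
  by rewrite negb_and !negbK => /orP[]/eqP ->; rewrite ?mul0r ?mulr0.
have E : a + b - g = (a - h) + (b - (g - h)).
  by rewrite opprB addrACA addKr.
case: (amax _ hu) (bmax _ vh) => [ha|Pah] [gb|Pb].
- by left; rewrite -gb ha addrC subrK.
- by right; rewrite E ha subrr add0r -ha.
- by right; rewrite E gb subrr addr0.
- by right; rewrite E PD.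
Qed.
End Leading.

(** An exponent that is both the largest and the smallest is the only one. *)
Lemma leading_two_sided (K : fieldType) (G : zmodType) (c : bicharacter K G)
  (P : pred G) (u : twisted c) a : positive_cone P ->
  leading P u a -> leading (fun g => P (- g)) u a -> u = tcoef u a *: tmon c a.
Proof.
move=> [P0 PD _] [ua amax] [_ amin]; apply: tcoef_inj => b.
rewrite tcoefZ tcoef_mon; have [->|ab] := eqVneq a b; first by rewrite mulr1.
rewrite mulr0; apply/eqP; apply: contraTT isT => ub.
have [/eqP|Pab] := amax _ ub; first by rewrite eq_sym (negPf ab).
have [/eqP|Pba] := amin _ ub; first by rewrite eq_sym (negPf ab).
by have := PD _ _ Pab Pba; rewrite subrr (negPf P0).
Qed.

(* Comparing extreme exponents on both sides pins both extreme exponents of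
   the left factor to [g]. *)
Lemma left_factor_mon (K : fieldType) (G : zmodType) (c : bicharacter K G)
  (P : pred G) (b u : twisted c) g : positive_cone P -> u != 0 ->
  b * u = u * tmon c g -> b = tcoef b g *: tmon c g.
Proof.
move=> cP u0 E.
have lead_g Q : positive_cone Q -> leading Q b g.
  move=> cQ; have [k uk] := ex_leading cQ u0.
  have gw := leadingM_max cQ uk (leading_mon c Q g); rewrite -E in gw.
  have b0 : b != 0.
    by apply: contraTneq (leading_neq0 gw) => ->; rewrite mul0r eqxx.
  have [a ba] := ex_leading cQ b0.
  have := leading_uniq cQ (leadingM_max cQ ba uk) gw.
  by rewrite [k + g]addrC => /addIr <-.
exact: leading_two_sided cP (lead_g _ cP) (lead_g _ (positive_cone_opp cP)).
Qed.

(* The extreme exponents of the two factors add up to [0] on both sides, and the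
   two nonnegative widths sum to zero. *)
Lemma unit_factor_mon (K : fieldType) (G : zmodType) (c : bicharacter K G)
  (P : pred G) (u v : twisted c) s : positive_cone P -> s != 0 ->
  u * v = s *: 1 -> exists g, u = tcoef u g *: tmon c g.
Proof.
move=> cP s0 E; have cP' := positive_cone_opp cP.
have uv0 : u * v != 0 by rewrite E scaler_eq0 negb_or s0 oner_eq0.
have u0 : u != 0 by apply: contraNneq uv0 => ->; rewrite mul0r.
have v0 : v != 0 by apply: contraNneq uv0 => ->; rewrite mulr0.
have lead1 Q : positive_cone Q -> leading Q (u * v) 0.
  move=> cQ; have [n1 nmax] := leading_mon c Q 0; rewrite E -tmon0.
  split=> [|b]; rewrite tcoefZ mulf_eq0 negb_or s0 //=; exact: nmax.
have [a ua] := ex_leading cP u0; have [b vb] := ex_leading cP v0.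
have [a' ua'] := ex_leading cP' u0; have [b' vb'] := ex_leading cP' v0.
have e := leading_uniq cP (leadingM_max cP ua vb) (lead1 _ cP).
have e' := leading_uniq cP' (leadingM_max cP' ua' vb') (lead1 _ cP').
case: (ua.2 _ ua'.1) => [a'a|Pa].
  by exists a; apply: leading_two_sided cP ua _; rewrite -a'a.
have [P0 PD _] := cP; case/negP: P0.
have -> : 0 = (a - a') + (b - b') by rewrite addrACA -opprD e e' subrr.
case: (vb.2 _ vb'.1) => [->|Pb]; last exact: PD.
by rewrite subrr addr0.
Qed.

(** * Lexicographic orders on integer vectors *)

Section Lexicographic.
Variables (I : finType) (r : I -> nat).
Hypothesis r_inj : injective r.
Local Notation G := {ffun I -> int}.

(** The lexicographic order in which [r] fixes the order of comparison; a free [r] allows a chosen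
    coordinate to be compared last. *)
Definition lexpos (g : G) : bool :=
  [exists i, (0 < g i) && [forall j, (r j < r i)%N ==> (g j == 0)]].

Lemma lexposP (g : G) :
  reflect (exists2 i, 0 < g i & forall j, (r j < r i)%N -> g j = 0) (lexpos g).
Proof.
apply: (iffP existsP) => [[i /andP[gi /forallP h]]|[i gi h]]; exists i => //.
  by move=> j ji; apply/eqP/(implyP (h j)).
by rewrite gi; apply/forallP => j; apply/implyP => /h ->.
Qed.

Lemma lexpos_cone : positive_cone lexpos.
Proof.
split=> [|g h /lexposP[i gi ig] /lexposP[j hj jh]|g g0].
- by apply/lexposP => -[i]; rewrite ffunE ltxx.
- apply/lexposP; case: (ltngtP (r i) (r j)) => ij.
  + exists i => [|k ki]; rewrite ffunE; first by rewrite (jh i) // addr0.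
    by rewrite ig ?jh // (ltn_trans ki).
  + exists j => [|k ki]; rewrite ffunE; first by rewrite (ig j) // add0r.
    by rewrite ig ?jh // (ltn_trans ki).
  + exists i => [|k ki]; rewrite ffunE; first by rewrite addr_gt0 // (r_inj ij).
    by rewrite ig ?jh // -?ij.
- have [i gi0] : exists i, g i != 0.
    apply/existsP; apply: contraR g0; rewrite negb_exists => /forallP h.
    by apply/eqP/ffunP => i; rewrite ffunE; apply/eqP; rewrite -[_ == _]negbK h.
  case: (arg_minnP r (P := fun i => g i != 0) gi0) => k gk kmin.
  have kz j : (r j < r k)%N -> g j = 0.
    by move=> jk; apply/eqP; apply: contraTT jk => /kmin; rewrite -leqNgt.
  case: (ltrgtP 0 (g k)) gk => // gk _; apply/orP; [left|right]; apply/lexposP.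
    by exists k.
  by exists k => [|j /kz gj]; rewrite ffunE ?oppr_gt0 // gj oppr0.
Qed.

(** The unit vector at the coordinate compared last is the least positive element, hence not a sum
    of two positive ones. *)
Lemma lexpos_last (g h : G) (l : I) : (forall i, r i <= r l)%N ->
  (lexpos g \/ g = 0) -> (lexpos h \/ h = 0) ->
  g + h = [ffun i => (i == l)%:R] \/ g + h = 0 -> g = 0 \/ h = 0.
Proof.
move=> lmax [/lexposP[i gi ig]|->]; last by left.
case=> [/lexposP[j hj jh]|->]; last by right.
(* At the earlier of the two first nonzero coordinates the sum is positive, so that coordinate can
   only be [l]. *)
have [ij|ji] := leqP (r i) (r j).
  have hi : 0 <= h i.
    move: ij; rewrite leq_eqVlt => /orP[/eqP/r_inj->|/jh->] //; exact: ltW.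
  case=> /ffunP/(_ i); rewrite !ffunE; last first.
    by move/eqP; rewrite gt_eqF // ltr_pwDl.
  case: eqP => [il|_ /eqP]; last by rewrite gt_eqF // ltr_pwDl.
  (* Now both vectors are at least 1 at [l], while their sum there is 1. *)
  have ei : i = j by apply: r_inj; apply/eqP; rewrite eqn_leq ij il lmax.
  by subst j => E; have {}E : g i + h i = 1 by []; lia.
have gj : 0 <= g j by rewrite ig.
case=> /ffunP/(_ j); rewrite !ffunE; last first.
  by move/eqP; rewrite gt_eqF // ltr_wpDl.
case: eqP => [jl|_ /eqP]; last by rewrite gt_eqF // ltr_wpDl.
by move: ji; rewrite jl ltnNge lmax.
Qed.
End Lexicographic.

(** * Commutation factors of monomials *)

Section Bicharacters.
Variables (K : fieldType) (G : zmodType) (c : bicharacter K G).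

Lemma bichNl g h : c (- g) h = (c g h)^-1.
Proof.
apply: (mulIf (bich_neq0 c g h)).
by rewrite -bichDl addNr bich0l mulVf ?bich_neq0.
Qed.

Lemma bichNr g h : c g (- h) = (c g h)^-1.
Proof.
apply: (mulIf (bich_neq0 c g h)).
by rewrite -bichDr addNr bich0r mulVf ?bich_neq0.
Qed.

(** The alternating bicharacter attached to [c]; it governs the exchange of two monomials. *)
Definition bcomm g h := c g h / c h g.

Lemma bcommDl g h k : bcomm (g + h) k = bcomm g k * bcomm h k.
Proof. by rewrite /bcomm bichDl bichDr invfM mulrACA. Qed.
Lemma bcommDr g h k : bcomm g (h + k) = bcomm g h * bcomm g k.
Proof. by rewrite /bcomm bichDl bichDr invfM mulrACA. Qed.
Lemma bcommNl g h : bcomm (- g) h = (bcomm g h)^-1.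
Proof. by rewrite /bcomm bichNl bichNr invfM. Qed.
Lemma bcommNr g h : bcomm g (- h) = (bcomm g h)^-1.
Proof. by rewrite /bcomm bichNl bichNr invfM. Qed.
Lemma bcomm_neq0 g h : bcomm g h != 0.
Proof. by rewrite mulf_neq0 ?invr_eq0 ?bich_neq0. Qed.

Lemma tmonC g h : tmon c g * tmon c h = bcomm g h *: (tmon c h * tmon c g).
Proof.
by rewrite !tmonM scalerA mulfVK ?bich_neq0 // addrC.
Qed.

(** Multiplication by a monomial only shifts exponents, so the relation can be compared coefficient
    by coefficient. This converts commutation into equations on exponents. *)
Lemma bcomm_supp (u : twisted c) t h : u * tmon c h = t *: (tmon c h * u) ->
  forall g, tcoef u g != 0 -> bcomm g h = t.
Proof.
move=> E g ug; have := congr1 (fun w => tcoef w (g + h)) E.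
rewrite /= tcoefMmonr tcoefZ [g + h]addrC tcoefMmonl mulrA /bcomm => /(mulIf ug) ->.
by rewrite mulfK ?bich_neq0.
Qed.
End Bicharacters.

(** * Commutation up to a scalar *)

Section QCommutation.
Variables (K : fieldType) (A : algType K).
Definition qcomm (t : K) (u v : A) := u * v = t *: (v * u).

Lemma qcommDl t u u' v : qcomm t u v -> qcomm t u' v -> qcomm t (u + u') v.
Proof. by rewrite /qcomm mulrDl mulrDr scalerDr => -> ->. Qed.
Lemma qcommDr t u v v' : qcomm t u v -> qcomm t u v' -> qcomm t u (v + v').
Proof. by rewrite /qcomm mulrDl mulrDr scalerDr => -> ->. Qed.
Lemma qcommZl t a u v : qcomm t u v -> qcomm t (a *: u) v.
Proof. by rewrite /qcomm -scalerAl -scalerAr => ->; rewrite !scalerA mulrC. Qed.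
Lemma qcommZr t a u v : qcomm t u v -> qcomm t u (a *: v).
Proof. by rewrite /qcomm -scalerAl -scalerAr => ->; rewrite !scalerA mulrC. Qed.
Lemma qcommBl t u u' v : qcomm t u v -> qcomm t u' v -> qcomm t (u - u') v.
Proof. by move=> h h'; rewrite -scaleN1r; apply/qcommDl/qcommZl. Qed.
Lemma qcommBr t u v v' : qcomm t u v -> qcomm t u v' -> qcomm t u (v - v').
Proof. by move=> h h'; rewrite -scaleN1r; apply/qcommDr/qcommZr. Qed.
Lemma qcommMr t s u v v' : qcomm t u v -> qcomm s u v' -> qcomm (t * s) u (v * v').
Proof.
rewrite /qcomm => h h'; rewrite mulrA h -scalerAl -(mulrA v u) h' -scalerAr scalerA.
by rewrite mulrA.
Qed.
Lemma qcomm1r u : qcomm 1 u 1.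
Proof. by rewrite /qcomm mulr1 mul1r scale1r. Qed.

Lemma qcomm_sym t u v : t != 0 -> qcomm t u v -> qcomm t^-1 v u.
Proof. by rewrite /qcomm => t0 ->; rewrite scalerA mulVf // scale1r. Qed.
End QCommutation.

(** * Bicharacters on a free abelian group *)

Section MatrixBicharacter.
Variables (K : fieldType) (I : finType) (m : I -> I -> K).
Hypothesis m_neq0 : forall i j, m i j != 0.
Local Notation G := {ffun I -> int}.

(** The bicharacter whose value on the basis vectors [evec i] and [evec j] is [m i j]. *)
Definition mxbich (g h : G) : K := \prod_i \prod_j m i j ^ (g i * h j).

Fact mxbichDl g h k : mxbich (g + h) k = mxbich g k * mxbich h k.
Proof.
rewrite /mxbich -big_split; apply: eq_bigr => i _; rewrite -big_split /=.
by apply: eq_bigr => j _; rewrite ffunE mulrDl expfzDr.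
Qed.
Fact mxbichDr g h k : mxbich g (h + k) = mxbich g h * mxbich g k.
Proof.
rewrite /mxbich -big_split; apply: eq_bigr => i _; rewrite -big_split /=.
by apply: eq_bigr => j _; rewrite ffunE mulrDr expfzDr.
Qed.
Fact mxbich_neq0 g h : mxbich g h != 0.
Proof.
by apply/prodf_neq0 => i _; apply/prodf_neq0 => j _; rewrite expfz_neq0.
Qed.
Definition mx_bicharacter := Bicharacter mxbichDl mxbichDr mxbich_neq0.

Definition evec (i : I) : G := [ffun j => (j == i)%:R].

Lemma mxbich_evecl i g : mxbich (evec i) g = \prod_j m i j ^ g j.
Proof.
rewrite /mxbich (bigD1 i) //= [X in _ * X]big1 ?mulr1 => [|k ki].
  by apply: eq_bigr => j _; rewrite ffunE eqxx mul1r.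
by apply: big1 => j _; rewrite ffunE (negPf ki) mul0r expr0z.
Qed.
Lemma mxbich_evecr i g : mxbich g (evec i) = \prod_j m j i ^ g j.
Proof.
rewrite /mxbich exchange_big /= (bigD1 i) //= [X in _ * X]big1 ?mulr1 => [|k ki].
  by apply: eq_bigr => j _; rewrite ffunE eqxx mulr1.
by apply: big1 => j _; rewrite ffunE (negPf ki) mulr0 expr0z.
Qed.
End MatrixBicharacter.

(** * The quantum torus and the images of the generators *)

Section QuantumTorus.
Variables (K : fieldType) (n : nat) (q : 'I_n -> K) (lam : 'I_n -> 'I_n -> K).
Hypothesis hq : forall i, q i != 0.
Hypothesis hlam : forall i j, lam i j != 0.
Local Notation I := ('I_n + 'I_n)%type.
Local Notation G := {ffun I -> int}.

(* [inl i] indexes the normal element [z_i = x_i y_i - y_i x_i], [inr i] the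
   generator [x_i]. *)
Definition qwa_mx (i j : I) : K :=
  match i, j with
  | inr a, inl b => if a == b then q a else 1
  | inr a, inr b => if (a < b)%N then lam a b else 1
  | _, _ => 1
  end.

Fact qwa_mx_neq0 i j : qwa_mx i j != 0.
Proof.
by case: i j => i [] j /=; rewrite ?oner_eq0 //; case: ifP; rewrite ?oner_eq0.
Qed.

Definition qbich : bicharacter K G := mx_bicharacter qwa_mx_neq0.

Definition zv (i : 'I_n) : G := evec (inl i).
Definition xv (i : 'I_n) : G := evec (inr i).

Lemma qbich_zr g i : qbich g (zv i) = q i ^ g (inr i).
Proof.
rewrite /qbich /= mxbich_evecr big_sumType /= big1 ?mul1r => [|j _]; last first.
  by rewrite exp1rz.
rewrite (bigD1 i) //= eqxx big1 ?mulr1 // => j /negPf ->; exact: exp1rz.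
Qed.

(** All rows of [qwa_mx] at [inl] are 1, so a factor [z_i] on the left multiplies monomials without
    any scalar. *)
Lemma qbich_zl g i : qbich (zv i) g = 1.
Proof. by rewrite /qbich /= mxbich_evecl; apply: big1 => j _; rewrite exp1rz. Qed.

Lemma qbich_xr g i :
  qbich g (xv i) = \prod_j qwa_mx (inr j) (inr i) ^ g (inr j).
Proof.
rewrite /qbich /= mxbich_evecr big_sumType /= big1 ?mul1r // => j _.
by rewrite exp1rz.
Qed.

Lemma qbich_xl g i : qbich (xv i) g =
  q i ^ g (inl i) * \prod_j qwa_mx (inr i) (inr j) ^ g (inr j).
Proof.
rewrite /qbich /= mxbich_evecl big_sumType /=; congr (_ * _).
rewrite (bigD1 i) //= eqxx big1 ?mulr1 // => j; rewrite eq_sym => /negPf ->.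
exact: exp1rz.
Qed.

Lemma xvE i j : (xv i (inr j) = (j == i)%:R) * (xv i (inl j) = 0).
Proof. by rewrite !ffunE. Qed.

Lemma qbich_xx i j : qbich (xv i) (xv j) = if (i < j)%N then lam i j else 1.
Proof.
rewrite qbich_xr (bigD1 i) //= xvE eqxx expr1z big1 ?mulr1 // => k /negPf ki.
by rewrite xvE ki expr0z.
Qed.

Lemma qbich_xz i j : qbich (xv i) (zv j) = if i == j then q i else 1.
Proof. by rewrite qbich_zr xvE eq_sym; case: eqP => [->|];
  rewrite ?expr1z ?expr0z. Qed.

Hypothesis hlamV : forall i j, lam i j = (lam j i)^-1.
Hypothesis hlam1 : forall i, lam i i = 1.

Lemma bcomm_xx i j : bcomm qbich (xv i) (xv j) = lam i j.
Proof.
rewrite /bcomm !qbich_xx; case: (ltngtP i j) => [_|_|/val_inj ->];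
  rewrite ?divr1 ?div1r ?hlam1 -?hlamV //.
Qed.

Lemma bcomm_gz g i : bcomm qbich g (zv i) = q i ^ g (inr i).
Proof. by rewrite /bcomm qbich_zr qbich_zl divr1. Qed.

Lemma bcomm_xz i j : bcomm qbich (xv i) (zv j) = if i == j then q i else 1.
Proof. by rewrite /bcomm qbich_xz qbich_zl divr1. Qed.

Lemma bcomm_zx i j : bcomm qbich (zv i) (xv j) = if i == j then (q i)^-1 else 1.
Proof.
by rewrite /bcomm qbich_xz qbich_zl mul1r eq_sym; case: eqP => [->|];
  rewrite ?invr1.
Qed.

Lemma bcomm_zz i j : bcomm qbich (zv i) (zv j) = 1.
Proof. by rewrite /bcomm !qbich_zl divr1. Qed.

Hypothesis hq1 : forall i, q i - 1 != 0.
Local Notation T := (twisted qbich).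

Definition tx i : T := tmon qbich (xv i).
(** This is [(z_i - 1) X_i^-1 / (q_i - 1)], obtained by solving [z_i = 1 + (q_i - 1) y_i x_i] for
    [y_i]. *)
Definition ty i : T :=
  (q i - 1)^-1 *: (tmon qbich (zv i - xv i) - tmon qbich (- xv i)).

Lemma qcomm_mon t g h : bcomm qbich g h = t ->
  qcomm t (tmon qbich g) (tmon qbich h).
Proof. by move=> <-; apply: tmonC. Qed.

Lemma txyM i : tx i * ty i = (q i - 1)^-1 *: (q i *: tmon qbich (zv i) - 1).
Proof.
have e1 : xv i + (zv i - xv i) = zv i by rewrite addrCA subrr addr0.
have e2 : qbich (xv i) (zv i - xv i) = q i.
  by rewrite bichDr bichNr qbich_xz qbich_xx ltnn eqxx invr1 mulr1.
have e3 : qbich (xv i) (- xv i) = 1 by rewrite bichNr qbich_xx ltnn invr1.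
by rewrite /tx /ty -scalerAr mulrBr !tmonM e1 e2 e3 subrr tmon0 scale1r.
Qed.

Lemma tyxM i : ty i * tx i = (q i - 1)^-1 *: (tmon qbich (zv i) - 1).
Proof.
have e2 : qbich (zv i - xv i) (xv i) = 1.
  by rewrite bichDl bichNl qbich_zl qbich_xx ltnn invr1 mulr1.
have e3 : qbich (- xv i) (xv i) = 1 by rewrite bichNl qbich_xx ltnn invr1.
by rewrite /tx /ty -scalerAl mulrBl !tmonM e2 e3 subrK addNr tmon0 !scale1r.
Qed.

(** For distinct indices the two monomials of [ty] have the same commutation factors, so everything
    reduces to values of [bcomm]. For equal indices the [z] terms of [txyM] and of [q i] times
    [tyxM] cancel. *)
Lemma torus_rels : qwa_rels q lam tx ty.
Proof.
split=> [i j ij|i].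
  have nij : (i == j) = false by apply/eqP => e; rewrite e ltnn in ij.
  have nji : (j == i) = false by rewrite eq_sym.
  have V k l : (lam k l)^-1 = lam l k by rewrite -hlamV.
  split.
  - by apply: qcomm_mon; rewrite bcomm_xx.
  - apply/qcommZl/qcommZr/qcommBl; apply/qcommBr; apply/qcomm_mon;
    by rewrite !(bcommDl, bcommDr, bcommNl, bcommNr) ?bcomm_xz ?bcomm_zx ?bcomm_zz
      ?bcomm_xx ?nij ?nji ?V ?invr1 ?mul1r ?mulr1 ?V.
  - apply/qcommZr/qcommBr; apply/qcomm_mon;
    by rewrite !(bcommDl, bcommDr, bcommNl, bcommNr) ?bcomm_xz ?bcomm_zx ?bcomm_zz
      ?bcomm_xx ?nij ?nji ?V ?invr1 ?mul1r ?mulr1.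
  - apply/qcommZr/qcommBr; apply/qcomm_mon;
    by rewrite !(bcommDl, bcommDr, bcommNl, bcommNr) ?bcomm_xz ?bcomm_zx ?bcomm_zz
      ?bcomm_xx ?nij ?nji ?V ?invr1 ?mul1r ?mulr1.
rewrite txyM tyxM; move: (tmon _ (zv i)) (hq1 i) => z h.
rewrite scalerA [q i * _]mulrC -scalerA -scalerBr [q i *: (z - 1)]scalerBr opprB.
rewrite [_ + (_ *: 1 - _)]addrC addrA subrK.
have -> : q i *: 1 - 1 = (q i - 1) *: 1 :> T by rewrite scalerBl scale1r.
by rewrite scalerA mulVf // scale1r.
Qed.
End QuantumTorus.

(** * Induction on elements of the universal algebra *)

Section Subalgebra.
Variables (K : fieldType) (A : algType K) (P : A -> Prop).
Hypothesis P1 : P 1.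
Hypothesis PZD : forall a u v, P u -> P v -> P (a *: u + v).
Hypothesis PM : forall u v, P u -> P v -> P (u * v).

(** Informative excluded middle makes an arbitrary property boolean, as the substructure mechanism
    requires. *)
Definition subalg_pred : {pred A} :=
  fun u => if excluded_middle_informative (P u) then true else false.

Lemma subalg_predP u : reflect (P u) (u \in subalg_pred).
Proof.
rewrite unfold_in; case: excluded_middle_informative => h; constructor; exact: h.
Qed.

Fact subalg_pred_closed : GRing.subalg_closed subalg_pred.
Proof.
split=> [|a u v /subalg_predP Pu /subalg_predP Pv|u v /subalg_predP Pu
  /subalg_predP Pv];
apply/subalg_predP; [exact: P1|exact: PZD|exact: PM].
Qed.
Record subalg := Subalg { subalg_val : A; _ : subalg_val \in subalg_pred }.
HB.instance Definition _ := [isSub for subalg_val].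
HB.instance Definition _ := [Choice of subalg by <:].
HB.instance Definition _ := GRing.SubChoice_isSubAlgebra.Build
  K A subalg_pred subalg (GRing.subalg_closed_semi subalg_pred_closed).

HB.instance Definition _ := GRing.isLinear.Build K subalg A *:%R subalg_val
  (fun _ _ _ => erefl).
HB.instance Definition _ := GRing.isMonoidMorphism.Build subalg A subalg_val
  (conj erefl (fun _ _ => erefl)).
(** The universal map into the subalgebra, followed by the inclusion, fixes the generators; by
    uniqueness it is the identity, so every element lies in the subalgebra. *)
Lemma initial_subalgebra (n : nat) (q : 'I_n -> K) lam (x y : 'I_n -> A) :
  is_qwa q lam x y -> (forall i, P (x i)) -> (forall i, P (y i)) ->
  forall u, P u.
Proof.
move=> [[rel1 rel2] univ] Px Py u.
have Sx i : x i \in subalg_pred by apply/subalg_predP.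
have Sy i : y i \in subalg_pred by apply/subalg_predP.
pose x' i : subalg := Subalg (Sx i); pose y' i : subalg := Subalg (Sy i).
have rel' : qwa_rels q lam x' y'.
  split=> [i j ij|i]; last by apply: val_inj; rewrite /= rel2.
  by have [r1 r2 r3 r4] := rel1 i j ij; split; apply: val_inj.
have [[f fxy] _] := univ _ _ _ rel'.
pose g : {lrmorphism A -> A} := subalg_val \o f.
have [_ uniq_A] := univ _ _ _ (conj rel1 rel2).
have : g u = idfun u.
  apply: (uniq_A g idfun) => i; have [fx fy] := fxy i.
  by rewrite /= fx fy.
rewrite /= => <-; exact/subalg_predP/valP.
Qed.
End Subalgebra.

(** * Words in generators that commute up to scalars *)

Section Words.
Variables (K : fieldType) (n : nat) (A : algType K).
Implicit Types (f : 'I_n -> A) (w : seq 'I_n).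

Definition wmon f w : A := \prod_(i <- w) f i.

Lemma wmon_cons f i w : wmon f (i :: w) = f i * wmon f w.
Proof. by rewrite /wmon big_cons. Qed.
Lemma wmon_cat f w w' : wmon f (w ++ w') = wmon f w * wmon f w'.
Proof. by rewrite /wmon big_cat. Qed.
Lemma wmon_nil f : wmon f [::] = 1.
Proof. by rewrite /wmon big_nil. Qed.

Variables (f : 'I_n -> A) (mu : 'I_n -> 'I_n -> K).
Hypothesis mu_neq0 : forall i j, mu i j != 0.
Hypothesis fC : forall i j, qcomm (mu i j) (f i) (f j).

Lemma qcomm_wmon1 i w : exists2 t, t != 0 & qcomm t (f i) (wmon f w).
Proof.
elim: w => [|j w [t t0 IH]].
  by exists 1; rewrite ?oner_eq0 // wmon_nil; apply: qcomm1r.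
by exists (mu i j * t); rewrite ?mulf_neq0 // wmon_cons; apply: qcommMr.
Qed.

Lemma qcomm_wmon w w' : exists2 t, t != 0 & qcomm t (wmon f w) (wmon f w').
Proof.
elim: w' => [|j w' [t t0 IH]].
  by exists 1; rewrite ?oner_eq0 // wmon_nil; apply: qcomm1r.
have [s s0 js] := qcomm_wmon1 j w.
exists (s^-1 * t); rewrite ?mulf_neq0 ?invr_eq0 // wmon_cons.
by apply: qcommMr => //; apply: qcomm_sym.
Qed.

(** Permutations are generated by exchanges of adjacent blocks, and each exchange costs one
    scalar. *)
Lemma wmon_perm w w' : perm_eq w w' -> exists a, wmon f w = a *: wmon f w'.
Proof.
move=> ww'; pose P w' := exists a, wmon f w = a *: wmon f w'.
apply: (catCA_perm_ind (P := P) _ ww'); last by exists 1; rewrite scale1r.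
move=> s1 s2 s3 [a E]; rewrite /P E.
have [t _ ts] := qcomm_wmon s1 s2.
by exists (a * t); rewrite !wmon_cat !mulrA ts -scalerAl scalerA.
Qed.
End Words.

Section ExponentWords.
Variable n : nat.
(** Sorted representative of all words with letter counts [a]. *)
Definition eword (a : {ffun 'I_n -> nat}) : seq 'I_n :=
  flatten [seq nseq (a i) i | i <- enum 'I_n].
Definition ecount (w : seq 'I_n) : {ffun 'I_n -> nat} := [ffun i => count_mem i w].

Lemma count_eword a i : count_mem i (eword a) = a i.
Proof.
rewrite /eword count_flatten -map_comp sumnE big_map big_enum /=.
rewrite (bigD1 i) //= count_nseq /= eqxx mul1n big1 ?addn0 // => j ji.
by rewrite count_nseq /= (negPf ji) mul0n.
Qed.

Lemma eword_count w : perm_eq w (eword (ecount w)).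
Proof. by apply/allP => i _ /=; rewrite count_eword ffunE. Qed.
End ExponentWords.

Lemma seq_argmax (B : eqType) (f : B -> nat) (s : seq B) : s != [::] ->
  exists2 a, a \in s & forall b, b \in s -> (f b <= f a)%N.
Proof.
elim: s => // b [_ _|b' s IH _].
  by exists b; rewrite ?mem_head // => c; rewrite mem_seq1 => /eqP ->.
have [//|a ains amax] := IH; have [ba|ab] := leqP (f b) (f a).
  exists a; first by rewrite in_cons ains orbT.
  by move=> c; rewrite in_cons => /orP[/eqP ->|/amax].
exists b; first by rewrite mem_head.
move=> c; rewrite in_cons => /orP[/eqP -> //|/amax /leq_trans]; apply; exact: ltnW.
Qed.

Lemma inrE (I J : eqType) (i j : J) : (inr i == inr j :> I + J) = (i == j).
Proof. by []. Qed.
Lemma inlE (I J : eqType) (i j : I) : (inl i == inl j :> I + J) = (i == j).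
Proof. by []. Qed.

(** * Consequences of the defining relations *)

Section Relations.
Variables (K : fieldType) (n : nat) (q : 'I_n -> K) (lam : 'I_n -> 'I_n -> K).
Hypothesis hlam : forall i j, lam i j != 0.
Hypothesis hlamV : forall i j, lam i j = (lam j i)^-1.
Hypothesis hlam1 : forall i, lam i i = 1.
Variables (B : algType K) (x y : 'I_n -> B).
Hypothesis hrel : qwa_rels q lam x y.

Lemma qwa_xx i j : qcomm (lam i j) (x i) (x j).
Proof.
case: hrel => [rel _]; case: (ltngtP i j) => [ij|ji|/val_inj ->].
- by have [] := rel i j ij.
- by have [r _ _ _] := rel j i ji; rewrite hlamV; apply: qcomm_sym.
- by rewrite /qcomm hlam1 scale1r.
Qed.

Lemma qwa_yy i j : qcomm (lam i j) (y i) (y j).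
Proof.
case: hrel => [rel _]; case: (ltngtP i j) => [ij|ji|/val_inj ->].
- by have [_ r _ _] := rel i j ij; rewrite hlamV; apply: qcomm_sym.
- by have [_ r _ _] := rel j i ji.
- by rewrite /qcomm hlam1 scale1r.
Qed.

Lemma qwa_xy i j : i != j -> qcomm (lam j i) (x i) (y j).
Proof.
case: hrel => [rel _]; case: (ltngtP i j) => [ij|ji|/val_inj ->] nij.
- by have [] := rel i j ij.
- by have [] := rel j i ji.
- by rewrite eqxx in nij.
Qed.

Lemma qwa_xyii i : x i * y i = q i *: (y i * x i) + 1.
Proof. by case: hrel => [_ rel]; rewrite -(rel i) addrC subrK. Qed.


(** Multiplying out, [x y - q y x = 1] is the same relation for the pair [y], [- q x] with parameter
    [q^-1]. The free scalars [a] cover both this exchange and its inverse. *)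
Lemma qwa_rels_swap (a q' : 'I_n -> K) (x' y' : 'I_n -> B) :
  (forall i, q i != 0) -> (forall i, a i != 0) -> (forall i, q' i = (q i)^-1) ->
  (forall i, x' i = a i *: y i) -> (forall i, y' i = - (q i / a i) *: x i) ->
  qwa_rels q' lam x' y'.
Proof.
move=> q0 a0 q'E x'E y'E; split=> [i j ij|i].
  have nij : i != j by apply/eqP => e; rewrite e ltnn in ij.
  rewrite !x'E !y'E; split.
  - by apply/qcommZl/qcommZr/qwa_yy.
  - by apply/qcommZl/qcommZr/qwa_xx.
  - by rewrite hlamV; apply/qcommZl/qcommZr/qcomm_sym => //; apply: qwa_xy;
    rewrite eq_sym.
  - by rewrite hlamV; apply/qcommZl/qcommZr/qcomm_sym => //; apply: qwa_xy.
rewrite x'E y'E q'E -!scalerAl -!scalerAr !scalerA qwa_xyii scalerDr scalerA.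
have -> : a i * - (q i / a i) = - q i by field.
have -> : (q i)^-1 * - (q i / a i) * a i = -1 by field; rewrite a0 q0.
by rewrite !scaleN1r mulN1r !scaleNr opprD !opprK addrA addNr add0r.
Qed.
End Relations.

(** * Spanning by ordered monomials and injectivity into the torus *)

Section Embedding.
Variables (K : fieldType) (n : nat) (q : 'I_n -> K) (lam : 'I_n -> 'I_n -> K).
Hypothesis hq : forall i, q i != 0.
Hypothesis hlam : forall i j, lam i j != 0.
Hypothesis hlamV : forall i j, lam i j = (lam j i)^-1.
Hypothesis hlam1 : forall i, lam i i = 1.
Hypothesis hq1 : forall i, q i - 1 != 0.
Variables (A : algType K) (x y : 'I_n -> A).
Hypothesis hA : is_qwa q lam x y.
Local Notation c := (qbich hq hlam).
Local Notation T := (twisted c).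

Local Notation E := ({ffun 'I_n -> nat} * {ffun 'I_n -> nat})%type.
Definition pbw (p : E) : A := wmon y (eword p.1) * wmon x (eword p.2).

Definition in_span (u : A) := exists g : {malg K[E]}, u = mext pbw g.

Lemma in_spanP a u v : in_span u -> in_span v -> in_span (a *: u + v).
Proof. by case=> g -> [h ->]; exists (a *: g + h); rewrite linearP. Qed.
Lemma in_span0 : in_span 0.
Proof. by exists 0; rewrite linear0. Qed.
Lemma in_spanZ a u : in_span u -> in_span (a *: u).
Proof. by move=> hu; rewrite -[_ *: u]addr0; apply: in_spanP in_span0. Qed.

Lemma words_in_span w v : in_span (wmon y w * wmon x v).
Proof.
have [a ->] := wmon_perm hlam (qwa_yy hlam hlamV hlam1 hA.1) (eword_count w).
have [b ->] := wmon_perm hlam (qwa_xx hlam hlamV hlam1 hA.1) (eword_count v).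
rewrite -scalerAl -scalerAr scalerA; apply: in_spanZ.
by exists << (ecount w, ecount v) >>; rewrite mextU.
Qed.

(** The letter [x i] travels to the right through the [y] word. Passing [y j] costs a scalar and,
    when [j = i], adds a term in which both letters vanish; the prefix [p] collects the letters
    already passed. *)
Lemma x_words_in_span i p w v :
  in_span (wmon y p * (x i * wmon y w) * wmon x v).
Proof.
elim: w p => [|j w IH] p.
  by rewrite wmon_nil mulr1 -mulrA -wmon_cons; apply: words_in_span.
rewrite wmon_cons; have [<-|ij] := eqVneq i j.
  rewrite [x i * _]mulrA (qwa_xyii hA.1) mulrDl mulrDr mulrDl -!scalerAl
    -scalerAr -scalerAl.
  apply: in_spanP; last by rewrite mul1r -wmon_cat; apply: words_in_span.
  have := IH (rcons p i); rewrite -cats1 wmon_cat wmon_cons wmon_nil mulr1.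
  by rewrite !mulrA.
rewrite [x i * _]mulrA (qwa_xy hA.1 ij) -!scalerAl -scalerAr -scalerAl.
apply: in_spanZ.
have := IH (rcons p j); rewrite -cats1 wmon_cat wmon_cons wmon_nil mulr1.
by rewrite !mulrA.
Qed.

Lemma span_mul u v : (forall p, in_span (u * pbw p)) -> in_span v -> in_span (u
  * v).
Proof.
move=> h [g ->]; rewrite /mext mulr_sumr; elim/big_rec: _ => [|p w _ IH].
  exact: in_span0.
by rewrite -scalerAr; apply: in_spanP.
Qed.

(** Elements whose left multiplication preserves the span form a subalgebra containing the
    generators; apply this to 1. *)
Lemma qwa_spanned u : in_span u.
Proof.
suff: forall v, in_span v -> in_span (u * v).
  move/(_ 1); rewrite mulr1; apply.
  by have := words_in_span [::] [::]; rewrite !wmon_nil mulr1.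
apply: (initial_subalgebra (P := fun u => forall v, in_span v -> in_span (u * v))
  _ _ _ hA) => [v|a w w' hw hw' v hv|w w' hw hw' v hv|i v|i v].
- by rewrite mul1r.
- by rewrite mulrDl -scalerAl; apply: in_spanP; auto.
- by rewrite -mulrA; auto.
- apply: span_mul => p; have := x_words_in_span i [::] (eword p.1) (eword p.2).
  by rewrite wmon_nil mul1r mulrA.
- apply: span_mul => p; rewrite mulrA -wmon_cons; exact: words_in_span.
Qed.

Variable F : {lrmorphism A -> T}.
Hypothesis Fx : forall i, F (x i) = tx hq hlam i.
Hypothesis Fy : forall i, F (y i) = ty hq hlam i.

(** The torus exponent of the word [y_w x_v] when every [y_j] contributes its term [z_j X_j^-1]. *)
Definition lexp (w v : seq 'I_n) : {ffun 'I_n + 'I_n -> int} :=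
  [ffun i => match i with
             | inl i => (count_mem i w)%:Z
             | inr i => (count_mem i v)%:Z - (count_mem i w)%:Z end].

Lemma tcoef_monM h (u : T) g : tcoef (tmon c h * u) g = c h (g - h) * tcoef u
  (g - h).
Proof. by rewrite -[g in LHS](subrK h) addrC tcoefMmonl. Qed.

Lemma tcoef_tyM i u g : tcoef (ty hq hlam i * u) g =
  (q i - 1)^-1 * (c (zv i - xv i) (g - (zv i - xv i)) * tcoef u (g - (zv i - xv i))
   - c (- xv i) (g - - xv i) * tcoef u (g - - xv i)).
Proof. by rewrite /ty -scalerAl tcoefZ mulrBl tcoefD tcoefN !tcoef_monM. Qed.

(** Both terms of [ty j] lower the degree in [X_j] by one, and only one of them carries a [z_j]. *)
Lemma words_supp w v g : tcoef (F (wmon y w * wmon x v)) g != 0 ->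
  forall i, [/\ g (inr i) = (count_mem i v)%:Z - (count_mem i w)%:Z,
    0 <= g (inl i) & g (inl i) <= (count_mem i w)%:Z].
Proof.
elim: w g => [|j w IH] g.
  rewrite wmon_nil mul1r.
  elim: v g => [|j v IH] g.
    rewrite wmon_nil rmorph1 -tmon0 tcoef_mon.
    have [<- _ i|] := eqVneq 0 g; last by rewrite eqxx.
    by rewrite !ffunE.
  rewrite wmon_cons rmorphM /= Fx tcoef_monM mulf_eq0 negb_or => /andP[_ /IH h] i.
  have [h1 h2 h3] := h i; move: h1 h2 h3; rewrite !ffunE /=.
  by rewrite ?inrE ?inlE ?natz ?[j == i]eq_sym; case: (i == j) => /= *; split; lia.
rewrite wmon_cons -mulrA rmorphM /= Fy tcoef_tyM mulf_eq0 negb_or => /andP[_ h].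
have : tcoef (F (wmon y w * wmon x v)) (g - (zv j - xv j)) != 0 \/
       tcoef (F (wmon y w * wmon x v)) (g - - xv j) != 0.
  have [e1|] := eqVneq (tcoef (F (wmon y w * wmon x v)) (g - (zv j - xv j))) 0;
    last by left.
  right; apply: contraNneq h => ->; by rewrite e1 !mulr0 subrr.
case=> /IH {}h i; have [h1 h2 h3] := h i; move: h1 h2 h3; rewrite !ffunE /=;
by rewrite ?inrE ?inlE ?natz ?[j == i]eq_sym; case: (i == j) => /= *; split; lia.
Qed.

Lemma words_lead w v : tcoef (F (wmon y w * wmon x v)) (lexp w v) != 0.
Proof.
elim: w => [|j w IH].
  rewrite wmon_nil mul1r.
  elim: v => [|j v IH].
    have -> : lexp [::] [::] = 0 by apply/ffunP => -[] i; rewrite !ffunE.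
    by rewrite wmon_nil rmorph1 -tmon0 tcoef_mon eqxx oner_eq0.
  rewrite wmon_cons rmorphM /= Fx tcoef_monM mulf_neq0 ?bich_neq0 //;
    congr (_ != 0): IH.
  congr tcoef; apply/ffunP => -[] i; rewrite !ffunE /= ?[inl _ == _]/= ?subr0 //.
  by rewrite ?inrE ?inlE ?natz ?[j == i]eq_sym; case: (i == j) => /=; lia.
rewrite wmon_cons -mulrA rmorphM /= Fy tcoef_tyM mulf_neq0 ?invr_eq0 //.
have -> : lexp (j :: w) v - (zv j - xv j) = lexp w v.
  apply/ffunP => -[] i; rewrite !ffunE /=;
  by rewrite ?inrE ?inlE ?natz ?[j == i]eq_sym; case: (i == j) => /=; lia.
(* The term of [ty j] without [z_j] would leave the shorter word with one [z_j] more than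
   [words_supp] allows. *)
have -> : tcoef (F (wmon y w * wmon x v)) (lexp (j :: w) v - - xv j) = 0.
  apply/eqP; apply: contraTT isT => /words_supp/(_ j)[_ _].
  by rewrite !ffunE /= eqxx; lia.
by rewrite mulr0 subr0 mulf_neq0 ?bich_neq0.
Qed.

(** The bound on [z] exponents gives [p.1 <= p'.1] pointwise; the bound on total degrees makes this
    an equality, and the [X] exponents then determine [p'.2]. *)
Lemma pbw_lead_uniq (p p' : E) g :
  g = lexp (eword p.1) (eword p.2) ->
  (\sum_i p'.1 i <= \sum_i p.1 i)%N ->
  tcoef (F (pbw p')) g != 0 -> p' = p.
Proof.
move=> -> le /words_supp h; have le1 i : (p.1 i <= p'.1 i)%N.
  by have [_ _] := h i; rewrite ffunE !count_eword lez_nat.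
have e1 i : p'.1 i = p.1 i.
  have : (\sum_i p.1 i == \sum_i p'.1 i)%N by rewrite eqn_leq le leq_sum.
  have /leqif_sum[_ ->] := fun i (_ : true) => leqif_eq (le1 i).
  by move=> /forallP/(_ i)/eqP.
have e2 i : p'.2 i = p.2 i.
  by have [+ _ _] := h i; rewrite ffunE !count_eword e1; lia.
by case: p p' {le h le1} e1 e2 => [a b] [a' b'] /= e1 e2; congr (_, _); apply/ffunP.
Qed.

Lemma embedding_inj : injective F.
Proof.
suff F0 u : F u = 0 -> u = 0.
  by move=> u v E; apply: subr0_eq; apply: F0; rewrite rmorphB /= E subrr.
have [g ->] := qwa_spanned u; have [-> _|g0] := eqVneq g 0;
  first by rewrite linear0.
(* Among the terms of [g], one of maximal total degree in the [y] is alone in reaching its own top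
   exponent, so its coefficient survives in [F u]. *)
have [|p pg pmax] := @seq_argmax _ (fun p : E => \sum_i p.1 i)%N (msupp g).
  apply: contra_neq g0 => s0; apply/malgP => k.
  by rewrite mcoeff0 mcoeff_outdom // -[_ \in _]/(k \in enum_fset _) s0.
move/(congr1 (fun t => tcoef t (lexp (eword p.1) (eword p.2)))) => /eqP.
rewrite tcoef0 /mext rmorph_sum /= tcoef_sum (big_fsetD1 p) //= big1_fset ?addr0.
  by rewrite linearZ tcoefZ mulf_eq0 (negPf (words_lead _ _)) orbF mcoeff_eq0 pg.
move=> p' /fsetD1P[p'p p'g] _; rewrite linearZ tcoefZ.
have [->|/(pbw_lead_uniq erefl (pmax _ p'g)) E] := eqVneq (tcoef (F (pbw p'))
  (lexp (eword p.1) (eword p.2))) 0.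
  by rewrite mulr0.
by rewrite E eqxx in p'p.
Qed.

(** No image of [A] contains a negative power of [z_i]; this keeps apart the elements of [A] and the
    units of the torus. *)
Lemma embedding_zexp_ge0 u g i : tcoef (F u) g != 0 -> 0 <= g (inl i).
Proof.
have [h ->] := qwa_spanned u; rewrite /mext rmorph_sum /= tcoef_sum => s0.
have [/hasP[p _ pg]|/hasPn none] :=
    boolP (has (fun p => tcoef (F (pbw p)) g != 0) (msupp h)).
  by have [] := words_supp pg i.
case/eqP: s0; apply: big1_seq => p /= /none; rewrite negbK => /eqP p0.
by rewrite linearZ tcoefZ p0 mulr0.
Qed.
End Embedding.

Lemma lexp_nil n : @lexp n [::] [::] = 0.
Proof. by apply/ffunP => -[] i; rewrite !ffunE. Qed.

Lemma lexp_cons n (i : 'I_n) w : lexp (i :: w) (i :: w) = zv i + lexp w w.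
Proof.
apply/ffunP => -[] j; rewrite !ffunE /= ?subrr //.
by rewrite ?inlE ?natz ?[i == j]eq_sym; case: (j == i) => /=; lia.
Qed.

Lemma bcomm_suppr (K : fieldType) (G : zmodType) (c : bicharacter K G)
  (u : twisted c) t g : qcomm t (tmon c g) u ->
  forall h, tcoef u h != 0 -> bcomm c g h = t.
Proof.
move=> E h uh; have := congr1 (fun w => tcoef w (g + h)) E.
rewrite /= tcoefMmonl tcoefZ [g + h]addrC tcoefMmonr mulrA /bcomm => /(mulIf uh) ->.
by rewrite mulfK ?bich_neq0.
Qed.

(** One half of the usual normality condition [u A = A u]. *)
Definition rnormal (K : fieldType) (A : algType K) (u : A) :=
  forall a, exists b, u * a = b * u.

Lemma rnormalM (K : fieldType) (A : algType K) (u v : A) :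
  rnormal u -> rnormal v -> rnormal (u * v).
Proof.
move=> hu hv a; have [b vb] := hv a; have [d ud] := hu b.
by exists d; rewrite -mulrA vb mulrA ud mulrA.
Qed.

Lemma rank_inj (I : finType) : injective (fun i : I => enum_rank i : nat).
Proof. by move=> i j /val_inj /enum_rank_inj. Qed.

(** The value [#|I|] lies above every rank of the enumeration, so [l] is compared last. *)
Definition rank_last (I : finType) (l i : I) : nat :=
  if i == l then #|I| else enum_rank i.

Lemma rank_last_inj (I : finType) (l : I) : injective (rank_last l).
Proof.
move=> i j; rewrite /rank_last; case: (eqVneq i l) (eqVneq j l) => [->|_] [->|_] //.
- by move=> e; have := ltn_ord (enum_rank j); rewrite -e ltnn.
- by move=> e; have := ltn_ord (enum_rank i); rewrite e ltnn.
- exact: rank_inj.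
Qed.

Lemma rank_last_max (I : finType) (l i : I) : (rank_last l i <= rank_last l l)%N.
Proof. by rewrite /rank_last eqxx; case: eqP => // _; rewrite ltnW. Qed.

(** * Normal elements seen in the torus *)

Section Normal.
Variables (K : fieldType) (n : nat) (q : 'I_n -> K) (lam : 'I_n -> 'I_n -> K).
Hypothesis hq : forall i, q i != 0.
Hypothesis hlam : forall i j, lam i j != 0.
Hypothesis hlamV : forall i j, lam i j = (lam j i)^-1.
Hypothesis hlam1 : forall i, lam i i = 1.
Hypothesis hroot : forall k (m : nat), (0 < m)%N -> q k ^+ m != 1.

Lemma q_sub1 i : q i - 1 != 0.
Proof. by rewrite subr_eq0 -[q i]expr1 hroot. Qed.

Lemma q_expz_eq1 i (m : int) : q i ^ m = 1 -> m = 0.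
Proof.
case: m => [[|m]|m] // /eqP; first by rewrite -exprnP (negPf (hroot i _)).
by rewrite NegzE -exprnN invr_eq1 (negPf (hroot i _)).
Qed.

Lemma q_expz_inj i (m m' : int) : q i ^ m = q i ^ m' -> m = m'.
Proof.
move=> E; apply: subr0_eq; apply: (@q_expz_eq1 i).
by rewrite expfzDr // E -expfzDr // subrr.
Qed.

Variables (A : algType K) (x y : 'I_n -> A).
Hypothesis hA : is_qwa q lam x y.
Local Notation c := (qbich hq hlam).
Local Notation T := (twisted c).

Lemma torus_embedding : exists F : {lrmorphism A -> T},
  [/\ forall i, F (x i) = tx hq hlam i, forall i, F (y i) = ty hq hlam i &
    injective F].
Proof.
have [[F h] _] := hA.2 _ _ _ (torus_rels hq hlam hlamV hlam1 q_sub1).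
have Fx i : F (x i) = tx hq hlam i by case: (h i).
have Fy i : F (y i) = ty hq hlam i by case: (h i).
exists F; split=> //; exact: (embedding_inj hlamV hlam1 q_sub1 hA Fx Fy).
Qed.

Definition qz i : A := 1 + (q i - 1) *: (y i * x i).

Section WithEmbedding.
Variable F : {lrmorphism A -> T}.
Hypothesis Fx : forall i, F (x i) = tx hq hlam i.
Hypothesis Fy : forall i, F (y i) = ty hq hlam i.
Hypothesis Finj : injective F.

Lemma embedding_eq0 u : (F u == 0) = (u == 0).
Proof. by rewrite -(inj_eq Finj) raddf0. Qed.

Lemma embedding_qz i : F (qz i) = tmon c (zv i).
Proof.
rewrite rmorphD rmorph1 /= linearZ rmorphM /= Fx Fy tyxM scalerA mulfV ?q_sub1 //.
by rewrite scale1r addrC subrK.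
Qed.

Lemma qcomm_of_embedding t u v : qcomm t (F u) (F v) -> qcomm t u v.
Proof.
by rewrite /qcomm -!rmorphM -linearZ /= => /Finj.
Qed.

Lemma qcomm_embedding t u v : qcomm t u v -> qcomm t (F u) (F v).
Proof. by rewrite /qcomm -!rmorphM => -> /=; rewrite linearZ. Qed.

Lemma tcoef_ty i : tcoef (ty hq hlam i) (zv i - xv i) != 0 /\
  tcoef (ty hq hlam i) (- xv i) != 0.
Proof.
have zx : (zv i - xv i == - xv i) = false.
  rewrite -[X in _ == X]add0r (inj_eq (addIr _)); apply/eqP => /ffunP/(_ (inl i)).
  by rewrite !ffunE eqxx.
rewrite /ty !tcoefZ !tcoefD !tcoefN !tcoef_mon !eqxx zx [- _ == _]eq_sym zx.
by rewrite subr0 sub0r !mulf_neq0 ?invr_eq0 ?q_sub1 ?oppr_eq0 ?oner_eq0.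
Qed.

(** In [u w = b u] the image of [b] is a multiple of [tmon c g] by [left_factor_mon], and
    injectivity of [F] makes [b] a multiple of [w]. *)
Lemma rnormal_qcomm_mon u w g : u != 0 -> rnormal u -> F w = tmon c g ->
  exists t, qcomm t u w.
Proof.
move=> u0 hu Fw; have [b E] := hu w; exists (tcoef (F b) g).
rewrite /qcomm E scalerAl; congr (_ * u); apply: Finj; rewrite linearZ /= Fw.
apply: (left_factor_mon (lexpos_cone (@rank_inj _)) (u := F u)).
  by rewrite embedding_eq0.
by rewrite -Fw -!rmorphM E.
Qed.

Lemma qcomm_zx i j : qcomm (if j == i then q i else 1) (x j) (qz i).
Proof.
apply: qcomm_of_embedding; rewrite Fx embedding_qz /tx; apply: qcomm_mon;
  rewrite bcomm_xz.
by case: eqP => [->|].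
Qed.

Lemma qcomm_zy i j : qcomm (if j == i then (q i)^-1 else 1) (y j) (qz i).
Proof.
apply: qcomm_of_embedding; rewrite Fy embedding_qz /ty; apply/qcommZl/qcommBl;
  apply: qcomm_mon.
  rewrite bcommDl bcommNl bcomm_xz bcomm_zz mul1r.
  by case: eqP => [->|]; rewrite ?invr1.
rewrite bcommNl bcomm_xz.
by case: eqP => [->|]; rewrite ?invr1.
Qed.

Lemma qz_neq0 i : qz i != 0.
Proof.
rewrite -embedding_eq0 embedding_qz;
  apply/eqP => /(congr1 (fun w => tcoef w (zv i))) /eqP.
by rewrite tcoef_mon tcoef0 eqxx oner_eq0.
Qed.

Lemma qz_not_scalar i s : qz i <> s *: 1.
Proof.
move=> /(congr1 (fun w => tcoef (F w) (zv i))) /eqP.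
rewrite /= linearZ rmorph1 embedding_qz tcoefZ -tmon0 !tcoef_mon eqxx.
suff -> : (0 == zv i) = false by rewrite mulr0 oner_eq0.
by apply/eqP => /ffunP/(_ (inl i)); rewrite !ffunE eqxx.
Qed.

Lemma rnormal_qz i : rnormal (qz i).
Proof.
have sw t u : t != 0 -> qcomm t u (qz i) -> exists b, qz i * u = b * qz i.
  by move=> t0 /(qcomm_sym t0) ->; exists (t^-1 *: u); rewrite scalerAl.
apply: (initial_subalgebra (P := fun a => exists b, qz i * a = b * qz i) _ _ _ hA).
- by exists 1; rewrite mulr1 mul1r.
- move=> a u v [b ub] [d vd]; exists (a *: b + d).
  by rewrite (mulrDr (qz i)) (mulrDl (a *: b)) -scalerAr -scalerAl ub vd.
- by move=> u v [b ub] [d vd]; exists (b * d);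
  rewrite (mulrA (qz i)) ub -mulrA vd mulrA.
- by move=> j; apply: (sw _ _ _ (qcomm_zx i j)); case: (j == i);
  rewrite ?hq ?oner_eq0.
- by move=> j; apply: (sw _ _ _ (qcomm_zy i j)); case: (j == i);
  rewrite ?invr_eq0 ?hq ?oner_eq0.
Qed.

Lemma embedding_qz_word w : F (wmon qz w) = tmon c (lexp w w).
Proof.
elim: w => [|i w IH]; first by rewrite wmon_nil rmorph1 -tmon0 lexp_nil.
by rewrite wmon_cons rmorphM /= embedding_qz IH tmonM qbich_zl scale1r lexp_cons.
Qed.

Lemma rnormal_qz_word w : rnormal (wmon qz w).
Proof.
elim: w => [|i w IH]; first by move=> a; exists a; rewrite wmon_nil mulr1 mul1r.
by rewrite wmon_cons; apply: rnormalM (rnormal_qz i) IH.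
Qed.

Lemma zexp_word (h : {ffun 'I_n + 'I_n -> int}) :
  (forall i, h (inr i) = 0) -> (forall i, 0 <= h (inl i)) ->
  exists w, h = lexp w w.
Proof.
move=> h0 hge; exists (eword [ffun i => `|h (inl i)|%N]).
apply/ffunP => -[] i; rewrite !ffunE ?subrr // count_eword ffunE.
by rewrite gez0_abs.
Qed.

(** Commutation with [z_i] reads off the exponent of [X_i]. *)
Lemma eigen_exp u i t : qcomm t u (qz i) ->
  forall g, tcoef (F u) g != 0 -> t = q i ^ g (inr i).
Proof.
move=> /qcomm_embedding; rewrite embedding_qz => E g ug.
by rewrite -(bcomm_supp E ug) bcomm_gz.
Qed.

Lemma embedding_ex_coef u : u != 0 -> exists g, tcoef (F u) g != 0.
Proof.
rewrite -embedding_eq0 => /(ex_leading (lexpos_cone (@rank_inj _)))[g []].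
by exists g.
Qed.

Lemma rnormal_mon u : u != 0 -> rnormal u -> exists g,
  F u = tcoef (F u) g *: tmon c g /\ tcoef (F u) g != 0.
Proof.
move=> u0 hu; have [g ug] := embedding_ex_coef u0; exists g; split=> //.
apply: tcoef_inj => h; rewrite tcoefZ tcoef_mon.
have [<-|gh] := eqVneq g h; first by rewrite mulr1.
rewrite mulr0; apply/eqP; apply: contraNT gh => uh; apply/eqP.
(* Two exponents of [F u] are compared: commutation with [z_i] equates their [X_i] parts. *)
have er i : g (inr i) = h (inr i).
  have [t ut] := rnormal_qcomm_mon u0 hu (embedding_qz i).
  by apply: (@q_expz_inj i); rewrite -(eigen_exp ut ug) (eigen_exp ut uh).
apply/ffunP => -[] i; last exact: er.
(* Commutation with [x_i] equates the [z_i] parts: once the [X] parts agree, the products over [j]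
   cancel and only powers of [q i] remain. *)
have [t /qcomm_embedding ut] := rnormal_qcomm_mon u0 hu (Fx i).
rewrite Fx in ut; have := bcomm_supp ut ug; rewrite -(bcomm_supp ut uh) /bcomm.
rewrite !qbich_xr !qbich_xl; under eq_bigr do rewrite er.
under [X in _ / (_ * X) = _]eq_bigr do rewrite er.
set a := \prod_j _; set b := \prod_j _.
have a0 : a != 0 by apply/prodf_neq0 => j _; rewrite expfz_neq0 ?qwa_mx_neq0.
have b0 : b != 0 by apply/prodf_neq0 => j _; rewrite expfz_neq0 ?qwa_mx_neq0.
by move/(mulfI a0)/invr_inj/(mulIf b0)/q_expz_inj.
Qed.

(** A factor of a nonzero scalar is a monomial in the torus, whereas [ty k] has two terms. *)
Lemma y_not_unit k v s : s != 0 -> y k * v <> s *: 1.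
Proof.
move=> s0 E; have [yz yx] := tcoef_ty k.
have [|g Eg] := unit_factor_mon (lexpos_cone (@rank_inj _)) s0 (u := F (y k))
  (v := F v).
  by rewrite -rmorphM E /= linearZ rmorph1.
rewrite Fy in Eg; move: yz yx; rewrite Eg !tcoefZ !tcoef_mon.
have [->|] := eqVneq g (zv k - xv k); last by rewrite mulr0 eqxx.
have [/eqP|] := eqVneq (zv k - xv k) (- xv k); last by rewrite mulr0 eqxx.
rewrite -[X in _ == X]add0r (inj_eq (addIr _)) => /eqP /ffunP/(_ (inl k)).
by rewrite !ffunE eqxx.
Qed.
End WithEmbedding.
End Normal.

(** * The twin presentation and the action of an automorphism on normal elements *)

Section Twin.
Variables (K : fieldType) (n : nat) (q : 'I_n -> K) (lam : 'I_n -> 'I_n -> K).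
Hypothesis hq : forall i, q i != 0.
Hypothesis hlam : forall i j, lam i j != 0.
Hypothesis hlamV : forall i j, lam i j = (lam j i)^-1.
Hypothesis hlam1 : forall i, lam i i = 1.
Hypothesis hroot : forall k (m : nat), (0 < m)%N -> q k ^+ m != 1.
Variables (A : algType K) (x y : 'I_n -> A).
Hypothesis hA : is_qwa q lam x y.

(** The exchange of [x] and [y] is invertible, so a family satisfying the twin relations is carried
    back to one satisfying the original relations, where universality applies. *)
Lemma qwa_twin : is_qwa (fun i => (q i)^-1) lam y (fun i => - q i *: x i).
Proof.
case: hA => rel univ; split.
  apply: (qwa_rels_swap hlam hlamV hlam1 rel hq (a := fun=> 1)) => // i.
  - by rewrite oner_eq0.
  - by rewrite scale1r.
  - by rewrite divr1.
move=> B u v relB.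
have relB' : qwa_rels q lam (fun i => - (q i)^-1 *: v i) u.
  apply: (qwa_rels_swap hlam hlamV hlam1 relB (a := fun i => - (q i)^-1)) => // i.
  - by rewrite invr_eq0.
  - by rewrite oppr_eq0 invr_eq0.
  - by rewrite invrK.
  - by rewrite invrN mulrN divff ?invr_eq0 // opprK scale1r.
have [[f fxy] _] := univ _ _ _ relB'; split.
  exists f => i; have [fx fy] := fxy i; split=> //.
  by rewrite linearZ /= fx scalerA mulrNN divff // scale1r.
move=> g h gh; have [_] := univ _ _ _ relB'; apply=> i; have [gy gx] := gh i.
split=> //; have := congr1 ( *:%R (- (q i)^-1)) gx.
by rewrite -!linearZ /= scalerA mulrNN divff // scale1r.
Qed.

Fact qV_neq0 i : (q i)^-1 != 0. Proof. by rewrite invr_eq0. Qed.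
Fact qV_root k (m : nat) : (0 < m)%N -> (q k)^-1 ^+ m != 1.
Proof. by move=> m0; rewrite exprVn invr_eq1 hroot. Qed.

Lemma rnormal_qcomm_y u i : u != 0 -> rnormal u -> exists t, qcomm t u (y i).
Proof.
move=> u0 hu; have [F [Fx _ Finj]] := torus_embedding qV_neq0 hlam hlamV hlam1
  qV_root qwa_twin.
exact: (rnormal_qcomm_mon Finj u0 hu (Fx i)).
Qed.

(** In the first torus [x k] becomes a unit; in the twin torus [- q k *: x k] has a two-term image,
    and [y_not_unit] applies. *)
Lemma x_not_unit k v s : s != 0 -> x k * v <> s *: 1.
Proof.
move=> s0 E; have [F [Fx Fy Finj]] := torus_embedding qV_neq0 hlam hlamV hlam1
  qV_root qwa_twin.
apply: (y_not_unit qV_root Fy (k := k) (v := v) (s := - q k * s)).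
  by rewrite mulf_neq0 // oppr_eq0.
by rewrite -scalerAl E scalerA.
Qed.

Local Notation c := (qbich hq hlam).
Local Notation T := (twisted c).
Variable F : {lrmorphism A -> T}.
Hypothesis Fx : forall i, F (x i) = tx hq hlam i.
Hypothesis Fy : forall i, F (y i) = ty hq hlam i.
Hypothesis Finj : injective F.
Local Notation z := (qz q x y).

Lemma rnormal_exp u : u != 0 -> rnormal u -> exists (w : seq 'I_n) a,
  a != 0 /\ F u = a *: tmon c (lexp w w).
Proof.
move=> u0 hu; have [g [E g0]] := rnormal_mon hroot Fx Fy Finj u0 hu.
(* The two exponents of [ty i] differ by [zv i]; since [F u] has the same commutation factor with
   both, its factor with [z_i], namely [q i ^ g (inr i)], is 1. *)
have ginr i : g (inr i) = 0.
  have [t /(qcomm_embedding F)] := rnormal_qcomm_y i u0 hu.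
  rewrite Fy E => /(qcommZl (tcoef (F u) g)^-1); rewrite scalerA mulVf // scale1r.
  move=> /bcomm_suppr ut; have [y1 y2] := tcoef_ty hq hlam hroot i.
  have := ut _ y1; rewrite -(ut _ y2) bcommDr -[X in _ = X]mul1r.
  by move/(mulIf (bcomm_neq0 _ _ _)); rewrite bcomm_gz => /(q_expz_eq1 hroot).
have [w gw] := zexp_word ginr (fun i => embedding_zexp_ge0 hlamV hlam1 hA Fx Fy
  i g0).
by exists w, (tcoef (F u) g); rewrite -gw.
Qed.

Lemma embedding_scalar u a : F u = a *: 1 -> u = a *: 1.
Proof. by move=> E; apply: Finj; rewrite linearZ rmorph1. Qed.

(** Every letter adds 1 to the total degree in the [z], which is 1 for [zv i]. *)
Lemma lexp_sum_zv w1 w2 (i : 'I_n) : lexp w1 w1 + lexp w2 w2 = zv i -> w1 =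
  [::] \/ w2 = [::].
Proof.
case: w1 w2 => [|j w1] [|k w2]; try by [left|right].
rewrite !lexp_cons => /ffunP E; exfalso.
have := E (inl j); have := E (inl k); rewrite !ffunE !inlE !natz.
rewrite !eqxx; have [->|ji] := eqVneq j i; have [->|ki] := eqVneq k i;
  rewrite ?eqxx ?(negPf ji) ?(negPf ki) /=; lia.
Qed.

Variable phi : {lrmorphism A -> A}.
Hypothesis phi_bij : bijective phi.

Lemma rnormal_phi u : rnormal (phi u) <-> rnormal u.
Proof.
case: phi_bij => psi phiK psiK; split=> h a.
  have [b E] := h (phi a); exists (psi b); apply: (can_inj phiK).
  by rewrite !rmorphM /= E psiK.
have [b E] := h (psi a); exists (phi b).
by rewrite -(psiK a) -!rmorphM E.
Qed.

Lemma phi_eq0 u : (phi u == 0) = (u == 0).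
Proof. by rewrite -(inj_eq (bij_inj phi_bij)) raddf0. Qed.

Lemma phi_scalar u a : phi u = a *: 1 -> u = a *: 1.
Proof. by move=> E; apply: (bij_inj phi_bij); rewrite E linearZ rmorph1. Qed.

(** An irreducibility argument: [phi (z i)] is a multiple of a product of [z] elements. Split off
    one factor [z j]; the preimages of the two factors are again normal and multiply to a multiple
    of [z i], so one of them is a scalar, and it cannot be the preimage of [z j]. *)
Lemma phi_qz i : exists j a, a != 0 /\ phi (z i) = a *: z j.
Proof.
have nz_i : rnormal (phi (z i)) by apply/rnormal_phi;
  apply: (rnormal_qz hroot hA Fx Fy Finj).
have phi0 : phi (z i) != 0 by rewrite phi_eq0 (qz_neq0 hroot Fx Fy Finj).
have [w [a [a0 E]]] := rnormal_exp phi0 nz_i.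
(* The empty word would make [z i] a scalar. *)
case: w E => [|j w] E.
  rewrite lexp_nil tmon0 in E.
  by case: (qz_not_scalar hroot Fx Fy (phi_scalar (embedding_scalar E))).
have {}E : phi (z i) = a *: (z j * wmon z w).
  apply: Finj; rewrite E linearZ rmorphM /= (embedding_qz hroot Fx Fy)
    (embedding_qz_word hroot Fx Fy).
  by rewrite tmonM qbich_zl scale1r -lexp_cons.
have [psi phiK psiK] := phi_bij.
pose b := psi (z j); pose d := psi (wmon z w).
have Eb : phi b = z j by rewrite /b psiK.
have Ed : phi d = wmon z w by rewrite /d psiK.
have {}E : z i = a *: (b * d).
  by apply: (can_inj phiK); rewrite E linearZ rmorphM /= Eb Ed.
have nb : rnormal b by apply/rnormal_phi; rewrite Eb;
  apply: (rnormal_qz hroot hA Fx Fy Finj).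
have nd : rnormal d.
  by apply/rnormal_phi; rewrite Ed; apply: (rnormal_qz_word hroot hA Fx Fy Finj).
have b0 : b != 0.
  by apply: contraTneq (qz_neq0 hroot Fx Fy Finj i) => b0;
    rewrite E b0 mul0r scaler0 eqxx.
have d0 : d != 0.
  by apply: contraTneq (qz_neq0 hroot Fx Fy Finj i) => d0;
    rewrite E d0 mulr0 scaler0 eqxx.
have [w1 [a1 [a10 E1]]] := rnormal_exp b0 nb.
have [w2 [a2 [a20 E2]]] := rnormal_exp d0 nd.
have : lexp w1 w1 + lexp w2 w2 = zv i.
  have := congr1 (fun u => tcoef (F u) (zv i)) E.
  rewrite /= (embedding_qz hroot Fx Fy) linearZ rmorphM /= E1 E2 -scalerAl
    -scalerAr.
  rewrite tmonM !tcoefZ !tcoef_mon eqxx; case: eqP => // _ /eqP.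
  by rewrite !mulr0 oner_eq0.
case/lexp_sum_zv => e; [move: E1|move: E2];
  rewrite e lexp_nil tmon0 => /embedding_scalar s.
  case: (qz_not_scalar hroot Fx Fy (i := j) (s := a1)).
  by rewrite -Eb s linearZ rmorph1.
exists j, (a * a2); rewrite mulf_neq0 //; split=> //.
rewrite E linearZ rmorphM /= Eb s linearZ rmorph1 /= -scalerAr mulr1.
by rewrite scalerA.
Qed.

(** In a product the widths, leading minus trailing exponent, add up. The width of [u v] is 0 or
    [zv k], indecomposable when [z_k] is compared last, so [u] or [v] is a monomial. If it is [v],
    then [v] is a multiple of [X_k^-1] and [x k * v] a nonzero scalar, which is excluded. *)
Lemma homogeneous_degree_one k u v p r : r != 0 ->
  (forall j, qcomm (if j == k then q k else 1) u (z j)) ->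
  (forall j, qcomm (if j == k then (q k)^-1 else 1) v (z j)) ->
  u * v = p *: z k + r *: 1 -> exists a, u = a *: x k.
Proof.
move=> r0 uz vz E.
have uv0 : u * v != 0.
  apply/eqP => uv; move: E; rewrite uv => /(congr1 (fun w => tcoef (F w) 0)).
  rewrite /= raddf0 raddfD /= !linearZ rmorph1 /= (embedding_qz hroot Fx Fy) tcoef0.
  rewrite tcoefD !tcoefZ -tmon0 !tcoef_mon eqxx.
  suff -> : (zv k == 0) = false by move/esym/eqP;
    rewrite mulr0 add0r mulr1 (negPf r0).
  by apply/eqP => /ffunP/(_ (inl k)); rewrite !ffunE eqxx.
have u0 : u != 0 by apply: contraNneq uv0 => ->; rewrite mul0r.
have v0 : v != 0 by apply: contraNneq uv0 => ->; rewrite mulr0.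
have udeg g : tcoef (F u) g != 0 -> forall j, g (inr j) = (j == k)%:R.
  move=> ug j; have := eigen_exp hroot Fx Fy (uz j) ug.
  have [->|jk] := eqVneq j k; first by rewrite -[LHS]expr1z => /(q_expz_inj hq
    hroot) <-.
  by move/esym/(q_expz_eq1 hroot).
have vdeg g : tcoef (F v) g != 0 -> forall j, g (inr j) = - (j == k)%:R.
  move=> vg j; have := eigen_exp hroot Fx Fy (vz j) vg.
  have [->|jk] := eqVneq j k; first by rewrite -exprN1 => /(q_expz_inj hq hroot) <-.
  by move/esym/(q_expz_eq1 hroot) => ->; rewrite oppr0.
have upos g i : tcoef (F u) g != 0 -> 0 <= g (inl i) by apply:
  (embedding_zexp_ge0 hlamV hlam1 hA Fx Fy).
have vpos g i : tcoef (F v) g != 0 -> 0 <= g (inl i) by apply: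
  (embedding_zexp_ge0 hlamV hlam1 hA Fx Fy).
have uv_supp g : tcoef (F u * F v) g != 0 -> g = zv k \/ g = 0.
  rewrite -rmorphM E /= raddfD /= !linearZ rmorph1 /= (embedding_qz hroot Fx Fy).
  rewrite tcoefD !tcoefZ -tmon0 !tcoef_mon.
  have [<-|_] := eqVneq (zv k) g; first by left.
  have [<-|_] := eqVneq 0 g; first by right.
  by rewrite !mulr0 addr0 eqxx.
have uv_0 : tcoef (F u * F v) 0 != 0.
  rewrite -rmorphM E /= raddfD /= !linearZ rmorph1 /= (embedding_qz hroot Fx Fy).
  rewrite tcoefD !tcoefZ -tmon0 !tcoef_mon eqxx.
  suff -> : (zv k == 0) = false by rewrite mulr0 add0r mulr1.
  by apply/eqP => /ffunP/(_ (inl k)); rewrite !ffunE eqxx.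
pose P := lexpos (rank_last (inl k : 'I_n + 'I_n)).
have rinj := @rank_last_inj _ (inl k : 'I_n + 'I_n).
have cP : positive_cone P by apply: lexpos_cone.
have cP' := positive_cone_opp cP.
have Fu0 : F u != 0 by rewrite (embedding_eq0 Finj).
have Fv0 : F v != 0 by rewrite (embedding_eq0 Finj).
have [a ua] := ex_leading cP Fu0; have [b vb] := ex_leading cP Fv0.
have [a' ua'] := ex_leading cP' Fu0; have [b' vb'] := ex_leading cP' Fv0.
have top := leadingM_max cP ua vb; have bot := leadingM_max cP' ua' vb'.
(* As [r != 0], the exponent 0 occurs in the product, so the larger exponent [zv k] cannot be the
   trailing one. *)
have bot0 : a' + b' = 0.
  case: (uv_supp _ bot.1) => // ez.
  case: (bot.2 _ uv_0) => [<- //|]; rewrite ez subr0 => /lexposP[i].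
  by rewrite !ffunE oppr_gt0 ltNge ler0n.
have dif : (a - a') + (b - b') = a + b by rewrite addrACA -opprD bot0 subr0.
have ge0 (w : T) e e' : leading P w e -> leading (fun g => P (- g)) w e' ->
  P (e - e') \/ e - e' = 0.
  by move=> we we'; case: (we.2 _ we'.1) => [->|]; [right; rewrite subrr|left].
have : a - a' = 0 \/ b - b' = 0.
  apply: (lexpos_last rinj (rank_last_max _) (ge0 _ _ _ ua ua') (ge0 _ _ _ vb vb')).
  by rewrite dif; exact: uv_supp top.1.
(* The [z] parts of the trailing exponents are nonnegative with sum 0. *)
have inl0 i : a' (inl i) = 0 /\ b' (inl i) = 0.
  have := upos _ i ua'.1; have := vpos _ i vb'.1.
  by have /ffunP/(_ (inl i)) := bot0; rewrite !ffunE;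
    move: (a' _) (b' _) => s t; lia.
case=> [/subr0_eq e|/subr0_eq e].
  exists (tcoef (F u) a); apply: Finj; rewrite linearZ /= Fx /tx.
  rewrite [LHS](leading_two_sided cP ua); last by rewrite e.
  congr (_ *: tmon _ _); apply/ffunP => -[] i; rewrite e ffunE.
    by rewrite (inl0 i).1.
  by rewrite (udeg _ ua'.1).
have Ev : F v = tcoef (F v) b *: tmon c (- xv k).
  rewrite [LHS](leading_two_sided cP vb); last by rewrite e.
  congr (_ *: tmon _ _); apply/ffunP => -[] i; rewrite e !ffunE.
    by rewrite (inl0 i).2 oppr0.
  by rewrite (vdeg _ vb'.1).
have vb0 : tcoef (F v) b * c (xv k) (- xv k) != 0.
  by rewrite mulf_neq0 ?bich_neq0 //; case: vb.
case: (x_not_unit (k := k) (v := v) vb0); apply: embedding_scalar.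
by rewrite rmorphM /= Fx [in LHS]Ev /tx -scalerAr tmonM subrr tmon0 scalerA.
Qed.
End Twin.

(** * Determination of the automorphism on generators *)

Section Homogeneous.
Variables (K : fieldType) (n : nat) (q : 'I_n -> K) (lam : 'I_n -> 'I_n -> K).
Hypothesis hq : forall i, q i != 0.
Hypothesis hlam : forall i j, lam i j != 0.
Hypothesis hlamV : forall i j, lam i j = (lam j i)^-1.
Hypothesis hlam1 : forall i, lam i i = 1.
Hypothesis hroot : forall k (m : nat), (0 < m)%N -> q k ^+ m != 1.
Variables (A : algType K) (x y : 'I_n -> A).
Hypothesis hA : is_qwa q lam x y.
Local Notation z := (qz q x y).

Lemma degree_plus_one k u v p r : r != 0 ->
  (forall j, qcomm (if j == k then q k else 1) u (z j)) ->
  (forall j, qcomm (if j == k then (q k)^-1 else 1) v (z j)) ->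
  u * v = p *: z k + r *: 1 -> exists a, u = a *: x k.
Proof.
have [F [Fx Fy Finj]] := torus_embedding hq hlam hlamV hlam1 hroot hA.
exact: (homogeneous_degree_one hlamV hlam1 hroot hA Fx Fy Finj).
Qed.

(** The twin presentation has the same normal elements up to scalars, so eigenvalue conditions carry
    over. *)
Lemma qz_twin j : qz (fun i => (q i)^-1) y (fun i => - q i *: x i) j = q j *: z j.
Proof.
rewrite /qz -scalerAl scalerA (qwa_xyii hA.1) !scalerDr !scalerA.
have -> : ((q j)^-1 - 1) * - q j = q j - 1 by field; rewrite hq.
rewrite addrCA [X in _ + X]addrC -[X in _ + (_ + X)]scale1r -scalerDl subrK.
by rewrite addrC mulrC.
Qed.

(** In the twin presentation [v] has degree one in the generator [y k], whose parameter is
    [(q k)^-1], so the previous case applies with the factors exchanged. *)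
Lemma degree_minus_one k u v p r : r != 0 ->
  (forall j, qcomm (if j == k then q k else 1) u (z j)) ->
  (forall j, qcomm (if j == k then (q k)^-1 else 1) v (z j)) ->
  v * u = p *: z k + r *: 1 -> exists a, v = a *: y k.
Proof.
move=> r0 uz vz E.
have hA' := qwa_twin hq hlam hlamV hlam1 hA.
have [F [Fx Fy Finj]] :=
  torus_embedding (qV_neq0 hq) hlam hlamV hlam1 (qV_root hroot) hA'.
apply: (homogeneous_degree_one hlamV hlam1 (qV_root hroot) hA' Fx Fy Finj (k :=
  k) (v := u)
  (p := p / q k) r0).
- by move=> j; rewrite qz_twin; apply: qcommZr.
- by move=> j; rewrite qz_twin invrK; apply: qcommZr.
- by rewrite qz_twin scalerA divfK.
Qed.

Lemma qwa_yx i : y i * x i = (q i - 1)^-1 *: z i + - (q i - 1)^-1 *: 1.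
Proof.
rewrite /qz scalerDr scalerA mulVf ?(q_sub1 hroot) // scale1r scaleNr.
by rewrite addrAC subrr add0r.
Qed.

Lemma qwa_xy_qz i : x i * y i = (q i / (q i - 1)) *: z i + - (q i - 1)^-1 *: 1.
Proof.
rewrite (qwa_xyii hA.1) qwa_yx scalerDr !scalerA -addrA; congr (_ + _).
rewrite -[X in _ + X]scale1r -scalerDl; congr (_ *: _).
by field; rewrite (q_sub1 hroot).
Qed.

Variable phi : {lrmorphism A -> A}.
Hypothesis phi_bij : bijective phi.

Lemma qcomm_phi t u v : qcomm t (phi u) (phi v) <-> qcomm t u v.
Proof.
rewrite /qcomm -!rmorphM; split=> [|-> /=]; last by rewrite linearZ.
by rewrite -linearZ; apply: bij_inj.
Qed.

Lemma eigen_qz u t k : u != 0 -> qcomm t u (z k) -> exists m : int, t = q k ^ m.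
Proof.
have [F [Fx Fy Finj]] := torus_embedding hq hlam hlamV hlam1 hroot hA.
move=> u0 ut; have [g ug] := embedding_ex_coef Finj u0.
by exists (g (inr k)); apply: (eigen_exp hroot Fx Fy ut ug).
Qed.

(** If [s i = s j], then [z i] and [z j] are proportional, which their torus exponents allow only
    for [i = j]. *)
Lemma phi_qz_perm : exists (s : {perm 'I_n}) (a : 'I_n -> K),
  forall i, a i != 0 /\ phi (z i) = a i *: z (s i).
Proof.
have [F [Fx Fy Finj]] := torus_embedding hq hlam hlamV hlam1 hroot hA.
have /fin_all_exists[s /fin_all_exists[a sa]] :=
  phi_qz hlamV hlam1 hroot hA Fx Fy Finj phi_bij.
suff s_inj : injective s by exists (perm s_inj), a => i; rewrite permE.
move=> i j sij; have [ai0 Ei] := sa i; have [aj0 Ej] := sa j.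
have : z i = (a i / a j) *: z j.
  by apply: (bij_inj phi_bij); rewrite linearZ /= Ei Ej sij scalerA divfK.
move/(congr1 (fun w => tcoef (F w) (zv i))).
rewrite /= linearZ /= !(embedding_qz hroot Fx Fy) tcoefZ !tcoef_mon eqxx.
case: (zv j =P zv i) => [e _|_ /eqP]; last by rewrite mulr0 oner_eq0.
by have /ffunP/(_ (inl i)) := e; rewrite !ffunE !inlE eqxx; case: eqP.
Qed.

Lemma scalar_eq1 (a : K) : a *: 1 = 1 :> A -> a = 1.
Proof.
move/eqP; rewrite -subr_eq0 -[X in _ - X]scale1r -scalerBl scaler_eq0 oner_eq0 orbF.
by rewrite subr_eq0 => /eqP.
Qed.

Lemma qwa_automorphism : exists (s : {perm 'I_n}) (alpha : 'I_n -> K),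
    (forall i, alpha i != 0) /\
    forall i,
      (phi (x i) = alpha i *: x (s i) /\
       phi (y i) = (alpha i)^-1 *: y (s i) /\
       q i = q (s i))
      \/
      (phi (x i) = alpha i *: y (s i) /\
       phi (y i) = - ((q i)^-1 * (alpha i)^-1) *: x (s i) /\
       q i = (q (s i))^-1).
Proof.
have [s [a sa]] := phi_qz_perm; exists s.
have [F [Fx Fy Finj]] := torus_embedding hq hlam hlamV hlam1 hroot hA.
have a0 i : a i != 0 by case: (sa i).
have phiz i : phi (z i) = a i *: z (s i) by case: (sa i).
suff /fin_all_exists[alpha h] : forall i, exists b : K, b != 0 /\
   ((phi (x i) = b *: x (s i) /\ phi (y i) = b^-1 *: y (s i) /\ q i = q (s i)) \/
    (phi (x i) = b *: y (s i) /\
     phi (y i) = - ((q i)^-1 * b^-1) *: x (s i) /\ q i = (q (s i))^-1)).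
  by exists alpha; split=> i; case: (h i).
move=> i; set k := s i; set u := phi (x i); set v := phi (y i).
have z_img t w j : qcomm t w (phi (z j)) -> qcomm t w (z (s j)).
  rewrite phiz => /(qcommZr (a j)^-1); by rewrite scalerA mulVf // scale1r.
(* Applying [phi] to the commutation of [x i] with the [z] elements keeps the eigenvalues and
   permutes the indices by [s]. *)
have uz j : qcomm (if j == k then q i else 1) u (z j).
  rewrite -(permKV s j) /k (inj_eq perm_inj); apply: z_img; apply/qcomm_phi.
  by have := qcomm_zx hroot Fx Fy Finj (s^-1%g j) i; rewrite eq_sym;
    case: eqP => [->|].
have vz j : qcomm (if j == k then (q i)^-1 else 1) v (z j).
  rewrite -(permKV s j) /k (inj_eq perm_inj); apply: z_img; apply/qcomm_phi.
  by have := qcomm_zy hroot Fx Fy Finj (s^-1%g j) i; rewrite eq_sym;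
    case: eqP => [->|].
have x0 j : x j != 0.
  apply/eqP => xj; have := qwa_xyii hA.1 j.
  by rewrite xj mulr0 mul0r scaler0 add0r => /esym/eqP; rewrite oner_eq0.
have u0 : u != 0 by rewrite (phi_eq0 phi_bij).
have [m Em] : exists m : int, q i = q k ^ m.
  by apply: (eigen_qz u0); have := uz k; rewrite eqxx.
(* The same eigenvalue argument for the preimage of [x k] under [phi]. *)
have [m' Em'] : exists m : int, q k = q i ^ m.
  have [psi phiK psiK] := phi_bij.
  apply: (@eigen_qz (psi (x k))).
    by rewrite -(phi_eq0 phi_bij) psiK.
  apply/qcomm_phi; rewrite psiK phiz; apply: qcommZr.
  by have := qcomm_zx hroot Fx Fy Finj k k; rewrite eqxx.
(* Combining both gives [q i ^ (m' * m) = q i], so [m' * m = 1] because [q i] is no root of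
   unity. *)
have mm : m = 1 \/ m = -1.
  have : q i ^ (m' * m) = q i ^ 1 by rewrite -exprz_exp -Em' -Em.
  move/(q_expz_inj hq hroot)/(congr1 absz)/eqP.
  by rewrite abszM muln_eq1 => /andP[_]; clear; lia.
have uvE : u * v = (q i / (q i - 1) * a i) *: z k + - (q i - 1)^-1 *: 1.
  by rewrite -rmorphM qwa_xy_qz /= raddfD /= !linearZ rmorph1 /= phiz scalerA.
have vuE : v * u = ((q i - 1)^-1 * a i) *: z k + - (q i - 1)^-1 *: 1.
  by rewrite -rmorphM qwa_yx /= raddfD /= !linearZ rmorph1 /= phiz scalerA.
have r0 : - (q i - 1)^-1 != 0 by rewrite oppr_eq0 invr_eq0 (q_sub1 hroot).
have weyl : u * v - q i *: (v * u) = 1.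
  by rewrite -!rmorphM (qwa_xyii hA.1) raddfD /= linearZ rmorph1 /= addrAC
    subrr add0r.
case: mm => em; rewrite em in Em.
  have qik : q i = q k by rewrite Em expr1z.
  rewrite qik in uz vz.
  have [b Eu] := degree_plus_one r0 uz vz uvE.
  have [d Ev] := degree_minus_one r0 uz vz vuE.
  have b0 : b != 0 by apply: contraNneq u0 => b0; rewrite Eu b0 scale0r.
  exists b; split=> //; left; split=> //; split=> //; rewrite Ev; congr (_ *: _).
  (* With [u = b x_k] and [v = d y_k], the image of the relation at [i] reads [b d = 1]. *)
  apply: (mulfI b0); rewrite divff //; apply: scalar_eq1.
  have := weyl; rewrite Eu Ev -!scalerAl -!scalerAr !scalerA (qwa_xyii hA.1) qik.
  rewrite scalerDr scalerA addrAC.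
  have -> : q k * d * b = b * d * q k by ring.
  by rewrite subrr add0r.
have qik : q i = (q k)^-1 by rewrite Em exprN1.
rewrite qik invrK in vz; rewrite qik in uz.
(* For [m = -1] the degrees in [X_k] are exchanged: [v] has degree 1 and [u] has degree -1. *)
have [d Ev] := degree_plus_one r0 vz uz vuE.
have [b Eu] := degree_minus_one r0 vz uz uvE.
have b0 : b != 0 by apply: contraNneq u0 => b0; rewrite Eu b0 scale0r.
exists b; split=> //; right; split=> //; split=> //; rewrite Ev; congr (_ *: _).
(* With [u = b y_k], [v = d x_k] and [q i * q k = 1], the [y_k x_k] terms of the relation cancel and
   this constant remains. *)
suff E : - (q i * d * b) = 1.
  have -> : d = - ((q i)^-1 * b^-1) * - (q i * d * b) by field; rewrite hq b0.
  by rewrite E mulr1.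
apply: scalar_eq1; have := weyl.
rewrite Eu Ev -!scalerAl -!scalerAr !scalerA (qwa_xyii hA.1) scalerDr scalerA.
have -> : q i * d * b * q k = b * d by rewrite qik; field; rewrite hq.
by rewrite opprD addrA subrr add0r scaleNr.
Qed.
End Homogeneous.

Theorem theorem2p1 (K : fieldType) (n : nat) (hn : (1 <= n)%N)
  (q : 'I_n -> K) (lam : 'I_n -> 'I_n -> K)
  (hq : forall i, q i != 0)
  (hlam : forall i j, lam i j != 0)
  (hlamV : forall i j, lam i j = (lam j i)^-1)
  (hlam1 : forall i, lam i i = 1)
  (hroot : forall k (m : nat), (0 < m)%N -> q k ^+ m != 1)
  (A : algType K) (x y : 'I_n -> A) (hA : is_qwa q lam x y)
  (phi : {lrmorphism A -> A}) (hphi : bijective phi) :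
  exists (sigma : {perm 'I_n}) (alpha : 'I_n -> K),
    (forall i, alpha i != 0) /\
    forall i,
      (phi (x i) = alpha i *: x (sigma i) /\
       phi (y i) = (alpha i)^-1 *: y (sigma i) /\
       q i = q (sigma i))
      \/
      (phi (x i) = alpha i *: y (sigma i) /\
       phi (y i) = - ((q i)^-1 * (alpha i)^-1) *: x (sigma i) /\
       q i = (q (sigma i))^-1).
Proof. exact: (qwa_automorphism hq hlam hlamV hlam1 hroot hA hphi). Qed.
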